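(* The category $\mathsf{QCB_0}(\mathbf{P})$ is the smallest full subcategory of $\mathsf{QCB_0}$ that inherits exponentials, finite limits and finite co-limits from $\mathsf{QCB_0}$ and contains the Sierpinski space and the space $\omega$ as objects; that is, $\mathsf{QCB_0}(\mathbf{P})$ has these properties, and every full subcategory of $\mathsf{QCB_0}$ with these properties contains a homeomorphic copy of every object of $\mathsf{QCB_0}(\mathbf{P})$.
   Context: $\mathcal{N}=\omega^\omega$ is the Baire space. A qcb$_0$-space is a $T_0$ topological space which is a topological quotient of a countably based space; $\mathsf{QCB_0}$ is the cartesian closed category of qcb$_0$-spaces and continuous maps, having all finite limits and co-limits. A full subcategory inherits a construction from $\mathsf{QCB_0}$ if the $\mathsf{QCB_0}$-construction applied to its objects yields its objects. The Sierpinski space $\mathbb{S}=\{\bot,\top\}$ has open sets $\emptyset,\{\top\},\{\bot,\top\}$; $\omega$ is discrete. A representation of a space $X$ is a surjection $\delta$ from $\mathit{dom}(\delta)\subseteq\mathcal{N}$ onto $X$; it is admissible if it is continuous and every continuous $\nu\colon Z\to X$ with $Z\subseteq\mathcal{N}$ satisfies $\nu=\delta g$ for some continuous $g\colon Z\to\mathcal{N}$. $\mathit{EQ}(\delta)=\{(p,q)\in\mathcal{N}^2\mid p,q\in\mathit{dom}(\delta),\ \delta(p)=\delta(q)\}$. For topological spaces $X$: $\mathbf{\Sigma}^1_0(X)$ = countable unions of differences of two open subsets of $X$, and $\mathbf{\Sigma}^1_{n+1}(X)=\{\{x\mid\exists p\in\mathcal{N}.(p,x)\in A\}\mid (\mathcal{N}\times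 X)\setminus A\in\mathbf{\Sigma}^1_n(\mathcal{N}\times X)\}$ for $n\in\omega$ (the projective hierarchy). $\mathsf{QCB_0}(\mathbf{\Sigma}^1_n)$ is the class of spaces having an admissible representation $\delta$ with $\mathit{EQ}(\delta)\in\mathbf{\Sigma}^1_n(\mathcal{N}^2)$. $\mathsf{QCB_0}(\mathbf{P})$ is the full subcategory of $\mathsf{QCB_0}$ with objects the spaces in $\bigcup_{n\in\omega}\mathsf{QCB_0}(\mathbf{\Sigma}^1_n)$ (projective qcb$_0$-spaces). *)

(* Defs.v *)
From HB Require Import structures.
From mathcomp Require Import all_boot.
From mathcomp Require Import boolp classical_sets functions cardinality.
From mathcomp Require Import topology.

Set Implicit Arguments.
Unset Strict Implicit.
Unset Printing Implicit Defensive.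

Local Open Scope classical_set_scope.

Definition baire : Type := prod_topology (fun _ : nat => nat).
HB.instance Definition _ := Topological.on baire.

(* false is the bottom point, true the top (open) point *)
Definition sierpinski : Type := bool.
HB.instance Definition _ := Choice.copy sierpinski bool.

Definition sierpinski_open (U : set sierpinski) : Prop :=
  [\/ U = set0, U = [set true] | U = setT].

Lemma sierpinski_openP (U : set sierpinski) :
  sierpinski_open U <-> (U false -> U true).
Proof.
split; first by case=> ->.
move=> h; have [Uf|nUf] := pselect (U false).
  by constructor 3; apply/seteqP; split=> // -[] _ //; exact: h.
have [Ut|nUt] := pselect (U true).
  by constructor 2; apply/seteqP; split=> [[]|x ->].
by constructor 1; apply/seteqP; split=> [[]|].
Qed.

Lemma sierpinski_openT : sierpinski_open setT.
Proof. by constructor 3. Qed.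

Lemma sierpinski_openI : setI_closed sierpinski_open.
Proof.
move=> A B /sierpinski_openP hA /sierpinski_openP hB.
by apply/sierpinski_openP => -[/hA ? /hB ?].
Qed.

Lemma sierpinski_open_bigU (I : Type) (f : I -> set sierpinski) :
  (forall i, sierpinski_open (f i)) -> sierpinski_open (\bigcup_i f i).
Proof.
move=> h; apply/sierpinski_openP => -[i _ fi]; exists i => //.
by move/sierpinski_openP: (h i); exact.
Qed.

HB.instance Definition _ := isOpenTopological.Build sierpinski
  sierpinski_openT sierpinski_openI sierpinski_open_bigU.

Definition homeomorphic (X Y : topologicalType) : Prop :=
  exists (f : X -> Y) (g : Y -> X),
    [/\ continuous f, continuous g, cancel f g & cancel g f].

Definition quotient_map (Y X : topologicalType) (q : Y -> X) : Prop :=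
  (forall x, exists y, q y = x) /\
  (forall U : set X, open U <-> open (q @^-1` U)).

Definition qcb0 (X : topologicalType) : Prop :=
  kolmogorov_space X /\
  exists (Y : topologicalType) (q : Y -> X),
    @second_countable Y /\ quotient_map q.

(* In the definitions below, D : set baire is coerced to the type of its
   elements, which carries the subspace topology. In particular the empty
   space has a representation, with empty domain. *)

Definition admissible (X : topologicalType) (D : set baire) (delta : D -> X) :
    Prop :=
  [/\ forall x, exists p, delta p = x,
      continuous delta &
      forall (Z : set baire) (nu : Z -> X), continuous nu ->
        exists2 g : Z -> baire, continuous g &
          forall z, exists2 p : D, set_val p = g z & delta p = nu z].

Definition EQ (X : Type) (D : set baire) (delta : D -> X) :
    set (baire * baire) :=
  [set pq | exists p q : D,
    [/\ set_val p = pq.1, set_val q = pq.2 & delta p = delta q]].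

Fixpoint Sigma1 (n : nat) (X : topologicalType) (A : set X) : Prop :=
  match n with
  | 0 => exists U V : nat -> set X,
      [/\ forall i, open (U i), forall i, open (V i) &
          A = \bigcup_i (U i `\` V i)]
  | m.+1 => exists2 B : set (baire * X)%type,
      @Sigma1 m (baire * X)%type (~` B) &
      A = [set x | exists p : baire, B (p, x)]
  end.

Definition QCB0_Sigma1 (n : nat) (X : topologicalType) : Prop :=
  qcb0 X /\
  exists (D : set baire) (delta : D -> X),
    admissible delta /\ @Sigma1 n (baire * baire)%type (EQ delta).

Definition QCB0_P (X : topologicalType) : Prop := exists n, QCB0_Sigma1 n X.

(* Finite limits, finite colimits and exponentials of the category of
   qcb0-spaces and continuous maps are given by their universal properties,
   tested against all qcb0-spaces. *)

Record fincat := Fincat {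
  fob :> finType;
  fhom : fob -> fob -> finType;
  fid : forall i, fhom i i;
  fcomp : forall i j k, fhom i j -> fhom j k -> fhom i k;
  fcompA : forall i j k l (u : fhom i j) (v : fhom j k) (w : fhom k l),
    fcomp u (fcomp v w) = fcomp (fcomp u v) w;
  fcomp1m : forall i j (u : fhom i j), fcomp (fid i) u = u;
  fcompm1 : forall i j (u : fhom i j), fcomp u (fid j) = u
}.

Record diagram (J : fincat) := Diagram {
  dob :> J -> topologicalType;
  dmap : forall i j : J, fhom i j -> dob i -> dob j;
  dmap_continuous : forall (i j : J) (u : fhom i j), continuous (dmap u);
  dmap1 : forall (i : J) (x : dob i), dmap (fid i) x = x;
  dmapM : forall (i j k : J) (u : fhom i j) (v : fhom j k) (x : dob i),
    dmap (fcomp u v) x = dmap v (dmap u x)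
}.

Definition cone (J : fincat) (F : diagram J) (L : topologicalType)
    (pi : forall i, L -> F i) : Prop :=
  (forall i, continuous (pi i)) /\
  (forall (i j : J) (u : fhom i j) (x : L), dmap u (pi i x) = pi j x).

Definition is_limit (J : fincat) (F : diagram J) (L : topologicalType)
    (pi : forall i, L -> F i) : Prop :=
  [/\ qcb0 L, cone pi &
      forall (Z : topologicalType) (rho : forall i, Z -> F i),
        qcb0 Z -> cone rho ->
        exists! f : Z -> L,
          continuous f /\ forall i z, pi i (f z) = rho i z].

Definition cocone (J : fincat) (F : diagram J) (L : topologicalType)
    (iota : forall i, F i -> L) : Prop :=
  (forall i, continuous (iota i)) /\
  (forall (i j : J) (u : fhom i j) (x : F i), iota j (dmap u x) = iota i x).

Definition is_colimit (J : fincat) (F : diagram J) (L : topologicalType)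
    (iota : forall i, F i -> L) : Prop :=
  [/\ qcb0 L, cocone iota &
      forall (Z : topologicalType) (rho : forall i, F i -> Z),
        qcb0 Z -> cocone rho ->
        exists! f : L -> Z,
          continuous f /\ forall i x, f (iota i x) = rho i x].

(* Products of qcb0-spaces do not carry the Tychonoff topology in general. *)
Definition is_product (X Y P : topologicalType) (p1 : P -> X) (p2 : P -> Y) :
    Prop :=
  [/\ qcb0 P, continuous p1, continuous p2 &
      forall (Z : topologicalType) (f : Z -> X) (g : Z -> Y),
        qcb0 Z -> continuous f -> continuous g ->
        exists! h : Z -> P,
          [/\ continuous h, forall z, p1 (h z) = f z &
              forall z, p2 (h z) = g z]].

(* E is the exponential of Y by X, with evaluation ev : E x X -> Y, where
   (P, p1, p2) is the product of E and X; the map h below is g x id_X. *)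
Definition is_exponential (X Y E P : topologicalType)
    (p1 : P -> E) (p2 : P -> X) (ev : P -> Y) : Prop :=
  [/\ qcb0 E, is_product p1 p2, continuous ev &
      forall (Z Q : topologicalType) (q1 : Q -> Z) (q2 : Q -> X) (f : Q -> Y),
        qcb0 Z -> is_product q1 q2 -> continuous f ->
        exists! g : Z -> E,
          continuous g /\
          exists h : Q -> P,
            [/\ continuous h, forall w, p1 (h w) = g (q1 w),
                forall w, p2 (h w) = q2 w & forall w, ev (h w) = f w]].

(* A full subcategory is identified with its class C of objects. It need not
   be closed under homeomorphism: inheriting a construction means that C
   contains some object having the universal property in the category of
   qcb0-spaces. *)

Definition full_subcategory_QCB0 (C : topologicalType -> Prop) : Prop :=
  forall X, C X -> qcb0 X.

Definition inherits_exponentials (C : topologicalType -> Prop) : Prop :=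
  forall X Y, C X -> C Y ->
  exists2 E, C E &
    exists (P : topologicalType) (p1 : P -> E) (p2 : P -> X) (ev : P -> Y),
      is_exponential p1 p2 ev.

Definition inherits_finite_limits (C : topologicalType -> Prop) : Prop :=
  forall (J : fincat) (F : diagram J), (forall i, C (F i)) ->
  exists2 L, C L & exists pi : forall i, L -> F i, is_limit pi.

Definition inherits_finite_colimits (C : topologicalType -> Prop) : Prop :=
  forall (J : fincat) (F : diagram J), (forall i, C (F i)) ->
  exists2 L, C L & exists iota : forall i, F i -> L, is_colimit iota.

Definition closed_subcategory (C : topologicalType -> Prop) : Prop :=
  [/\ full_subcategory_QCB0 C, inherits_exponentials C,
      inherits_finite_limits C, inherits_finite_colimits C &
      C sierpinski /\ C nat].

(* Main.v *)
(* A qcb0-space X is the quotient of a subspace of the Baire space by a naming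
   relation rho, and its open sets are coded by the p for which the open set Ob p
   is rho-saturated. Naming x by the codes of the open set of all saturated p
   whose open set contains x turns any quotient naming of a T0 space into an
   admissible one, without leaving the projective sets. So a T0 space is in
   QCB0(P) as soon as some quotient naming of it has a projective kernel, and for
   finite limits, T0-quotients of finite coproducts, and function spaces (a map f
   being coded by the open set of pairs (a, p) such that f of the point named by a
   lies in the open set coded by p) the kernel is defined from the given ones by
   quantification over the Baire space.

   Conversely, let a full subcategory C have the closure properties. Up to
   homeomorphism it contains the Baire space, as an exponential. If B is in C and
   pi : B -> Z is continuous with Z Hausdorff, the complement of the image of pi
   is the equalizer of two maps from Z to the exponential of the Sierpinski space
   by B, namely x |-> (b |-> pi b <> x) and the constantly true map. Hence C
   contains every projective subspace of the Baire space, in particular the domain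
   and the kernel of the naming of X, of which X is a coequalizer. *)

Require Import Defs.
From HB Require Import structures.
From mathcomp Require Import all_boot.
From mathcomp Require Import boolp classical_sets functions cardinality topology.

Set Implicit Arguments.
Unset Strict Implicit.
Unset Printing Implicit Defensive.

Local Open Scope classical_set_scope.

(** * The Baire space *)

Definition agree (n : nat) (p q : nat -> nat) : Prop :=
  forall i, i < n -> p i = q i.

Lemma agree_refl n p : agree n p p. Proof. by []. Qed.

Lemma agree_sym n p q : agree n p q -> agree n q p.
Proof. by move=> h i /h. Qed.

Lemma agree_trans n p q r : agree n p q -> agree n q r -> agree n p r.
Proof. by move=> h h' i ni; rewrite h // h'. Qed.

Lemma agree_le m n p q : m <= n -> agree n p q -> agree m p q.
Proof. by move=> mn h i im; apply: h; exact: leq_trans mn. Qed.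

Lemma agree_maxl m n p q : agree (maxn m n) p q -> agree m p q.
Proof. exact/agree_le/leq_maxl. Qed.

Lemma agree_maxr m n p q : agree (maxn m n) p q -> agree n p q.
Proof. exact/agree_le/leq_maxr. Qed.

Lemma agree_mkseq n p q : mkseq p n = mkseq q n <-> agree n p q.
Proof.
split=> [h i ni|h]; first by have := congr1 (nth 0 ^~ i) h; rewrite !nth_mkseq.
by apply/eq_in_map => i; rewrite mem_iota => /andP[_ ni]; exact: h.
Qed.

Definition agree_filter (p : baire) : set_system baire :=
  [set A | exists n, forall q, agree n p q -> A q].

Lemma agree_filter_filter p : Filter (agree_filter p).
Proof.
split; first by exists 0.
- move=> A B [n An] [m Bm]; exists (maxn n m) => q h; split.
    by apply: An; exact: agree_maxl h.
  by apply: Bm; exact: agree_maxr h.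
- by move=> A B AB [n An]; exists n => q /An /AB.
Qed.

Lemma nbhs_nat (m : nat) (A : set nat) : nbhs m A <-> A m.
Proof.
split; first exact: nbhs_singleton.
by move=> Am; rewrite nbhs_principalE; exact/principal_filterP.
Qed.

Lemma continuous_eval (i : nat) : continuous (fun p : baire => p i).
Proof. exact: (@proj_continuous nat (fun=> nat) i). Qed.

(** Cylinders are neighbourhoods by induction on their length, one coordinate condition at a time.
    Conversely the cylinder filter converges to [p]: the product topology is the supremum of the
    topologies induced by the coordinates, and each coordinate is constant on a cylinder. *)
Lemma nbhs_baireP (p : baire) (A : set baire) :
  nbhs p A <-> exists n, forall q, agree n p q -> A q.
Proof.
split; last first.
  case=> n; elim: n A => [|n IH] A h.
    by have -> : A = setT; [apply/seteqP; split=> // q _; exact: h|exact: filterT].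
  have : nbhs p [set q : baire | q n = p n].
    by apply: (@continuous_eval n p [set p n]); exact/nbhs_nat.
  have /IH : forall q, agree n p q -> (fun q => q n = p n -> A q) q.
    move=> q pq qn; apply: h => i; rewrite ltnS leq_eqVlt => /orP[/eqP->//|].
    exact: pq.
  by apply: filterS2 => q; apply.
have FF := agree_filter_filter p.
have cv : agree_filter p --> p.
  apply/(@cvg_sup _ _ _ (agree_filter p) p) => i B.
  rewrite nbhsE => -[_ [[C oC <-] Cp] CB].
  by exists i.+1 => q pq; apply: CB => /=; rewrite /= -(pq i).
exact: cv.
Qed.

Lemma nbhs_agree (p : baire) n : nbhs p (agree n p).
Proof. by apply/nbhs_baireP; exists n. Qed.

Lemma nbhs_sub (T : topologicalType) (D : set T) (x : D) (A : set D) :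
  nbhs x A <-> exists2 B, nbhs (set_val x) B & set_val @^-1` B `<=` A.
Proof.
split.
  rewrite nbhsE => -[_ [[C oC <-] Cx] CA]; exists C => //.
  by exists C.
case=> B Bx BA; apply: filterS BA _.
exact: (@initial_continuous _ _ (@set_val T D) x).
Qed.

Lemma continuous_val (T : topologicalType) (D : set T) :
  continuous (@set_val T D).
Proof. exact: initial_continuous. Qed.

Lemma continuous_to_sub (S T : topologicalType) (D : set T) (f : S -> D) :
  continuous (fun s => set_val (f s)) -> continuous f.
Proof.
move=> cf s A /nbhs_sub[B Bs BA].
have : nbhs s [set t | B (set_val (f t))] by exact: cf Bs.
by apply: filterS => t; exact: BA.
Qed.

Lemma continuous_to_baire (T : topologicalType) (f : T -> baire) :
  (forall i, continuous (fun t => f t i)) -> continuous f.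
Proof.
move=> cf t A /nbhs_baireP[n An].
suff : nbhs t [set t' | agree n (f t) (f t')] by apply: filterS => t' /An.
elim: n {An} => [|n IH]; first by apply: filterE => t' i.
have : nbhs t [set t' | f t' n = f t n].
  by apply: (cf n t [set f t n]); exact/nbhs_nat.
apply: filterS2 IH => t' h hn i; rewrite ltnS leq_eqVlt => /orP[/eqP->//|].
exact: h.
Qed.

Lemma continuous_to_nat (T : topologicalType) (f : T -> nat) :
  (forall t, nbhs t [set t' | f t' = f t]) -> continuous f.
Proof.
by move=> h t A /nbhs_nat At; apply: filterS (h t) => t' /= ->.
Qed.

Lemma continuous_pair (S T U : topologicalType) (f : S -> T) (g : S -> U) :
  continuous f -> continuous g -> continuous (fun s => (f s, g s)).
Proof. by move=> cf cg s; apply: cvg_pair; [exact: cf|exact: cg]. Qed.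

Lemma continuous_fst (T U : topologicalType) : continuous (@fst T U).
Proof. by move=> x; exact: cvg_fst. Qed.

Lemma continuous_snd (T U : topologicalType) : continuous (@snd T U).
Proof. by move=> x; exact: cvg_snd. Qed.

Lemma continuous_compose (R S T : topologicalType) (f : R -> S) (g : S -> T) :
  continuous f -> continuous g -> continuous (fun x => g (f x)).
Proof. by move=> cf cg x; exact: (continuous_comp (cf x) (cg (f x))). Qed.

Lemma continuous_const (S T : topologicalType) (y : T) :
  continuous (fun _ : S => y).
Proof. exact: cst_continuous. Qed.

Lemma continuous_ident (S : topologicalType) : continuous (fun x : S => x).
Proof. by move=> x A. Qed.

(** * Coding countably many points of the Baire space by one *)

Section slices.
Variable I : countType.

Definition slice (i : I) (p : baire) : baire := fun n => p (pickle (i, n)).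

(** Values are interleaved through [pickle]; a position that encodes no pair gets the default value
    0. *)
Definition join (f : I -> baire) : baire := fun m =>
  if unpickle m is Some (i, n) then f i n else 0.

Lemma slice_join i f : slice i (join f) = f i.
Proof. by apply/funext => n; rewrite /slice /join pickleK. Qed.

Lemma continuous_slice i : continuous (slice i).
Proof. by apply: continuous_to_baire => n; exact: continuous_eval. Qed.

Lemma continuous_join (T : topologicalType) (f : T -> I -> baire) :
  (forall i, continuous (f^~ i)) -> continuous (fun t => join (f t)).
Proof.
move=> cf; apply: continuous_to_baire => m; rewrite /join.
case: unpickle => [[i n]|]; last exact: continuous_const.
exact: (continuous_compose (cf i) (@continuous_eval n)).
Qed.

End slices.

Definition pair2 (a b : baire) : baire := join (fun c : bool => if c then b else a).
Definition part1 (p : baire) : baire := slice false p.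
Definition part2 (p : baire) : baire := slice true p.

Lemma part1_pair a b : part1 (pair2 a b) = a.
Proof. exact: slice_join. Qed.

Lemma part2_pair a b : part2 (pair2 a b) = b.
Proof. exact: slice_join. Qed.

Lemma continuous_pair2 (T : topologicalType) (f g : T -> baire) :
  continuous f -> continuous g -> continuous (fun t => pair2 (f t) (g t)).
Proof. by move=> cf cg; apply: continuous_join => -[]. Qed.

Lemma continuous_part1 : continuous part1.
Proof. exact: continuous_slice. Qed.

Lemma continuous_part2 : continuous part2.
Proof. exact: continuous_slice. Qed.

Lemma continuous_agree (f : baire -> baire) (p : baire) n :
  continuous f -> exists m, forall q, agree m p q -> agree n (f p) (f q).
Proof. by move=> cf; have /nbhs_baireP := cf p _ (nbhs_agree (f p) n). Qed.

Definition consB (n : nat) (p : baire) : baire :=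
  fun m => if m is m'.+1 then p m' else n.
Definition tailB (p : baire) : baire := fun m => p m.+1.

Lemma continuous_tail : continuous tailB.
Proof. by apply: continuous_to_baire => n; exact: continuous_eval. Qed.

Lemma continuous_cons n : continuous (consB n).
Proof.
by apply: continuous_to_baire => -[|i]; [exact: continuous_const|exact: continuous_eval].
Qed.

(** * Codes of open sets and namings *)

Lemma T0P (X : topologicalType) :
  kolmogorov_space X <->
  forall x y : X, (forall U, open U -> U x <-> U y) -> x = y.
Proof.
split=> [T0 x y xy|T0 x y /eqP xy].
  apply: contrapT => /eqP /T0[A]; rewrite !inE !nbhsE.
  case=> -[[B [oB Bz] BA] /= nA]; apply: nA; apply: BA; exact/(xy _ oB).
apply: contrapT => h; apply: xy; apply: T0 => U oU.
split=> Uz; apply: contrapT => nU; apply: h; exists U; [left|right];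
  rewrite !inE; split=> //; exact: open_nbhs_nbhs.
Qed.

(* p codes the open set of the points k with Ob p k. The number l carries no
   information: it lets a code depending continuously on a parameter list a
   cylinder only once enough of the parameter has been read. *)
Definition Ob (p k : nat -> nat) : Prop :=
  exists l n : nat, p (pickle (l, mkseq k n)) != 0.

Lemma Ob_agree p k : Ob p k ->
  exists n, forall p' k', agree n p p' -> agree n k k' -> Ob p' k'.
Proof.
move=> [l [n pn]]; set c := pickle _ in pn.
exists (maxn c.+1 n) => p' k' pp' kk'; exists l, n.
have /agree_mkseq <- : agree n k k' by exact: agree_maxr kk'.
by rewrite -(agree_maxl pp').
Qed.

(** [Z] carries the initial topology for [e], written with cylinders. This treats the Baire space
    and its subspaces uniformly. *)
Definition embedded (Z : topologicalType) (e : Z -> baire) : Prop :=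
  forall z A, nbhs z A <-> exists n, forall z', agree n (e z) (e z') -> A z'.

Lemma embedded_val (D : set baire) : embedded (@set_val baire D).
Proof.
move=> z A; split=> [/nbhs_sub[B /nbhs_baireP[n Bn] BA]|[n An]].
  by exists n => z' zz'; apply: BA; exact: Bn.
apply/nbhs_sub; exists (agree n (set_val z)); first exact: nbhs_agree.
by move=> z'; exact: An.
Qed.

Lemma embedded_id : embedded (fun p : baire => p).
Proof. exact: nbhs_baireP. Qed.

(** Relative openness in Z x K of the set of pairs (z, k) with [A z k], where points of [Z] are seen
    through [e]. *)
Definition open_on (Z : Type) (e : Z -> baire) (K : set baire)
    (A : Z -> set baire) : Prop :=
  forall z k, K k -> A z k -> exists n, forall z' k',
    agree n (e z) (e z') -> agree n k k' -> K k' -> A z' k'.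

(** The code at z lists (l, s) when the cylinder of s, within [K], lies in A z' for every z'
    agreeing with z up to l. This depends only on the first l values of [e z], so the code is
    continuous in z. *)
Lemma open_on_code (Z : topologicalType) (e : Z -> baire) K A :
  embedded e -> open_on e K A ->
  exists2 g : Z -> baire, continuous g &
    forall z k, K k -> Ob (g z) k <-> A z k.
Proof.
move=> emb oA.
pose good z l (s : seq nat) := forall z' k', agree l (e z) (e z') -> K k' ->
  mkseq k' (size s) = s -> A z' k'.
pose g z : baire := fun j =>
  if @unpickle (nat * seq nat)%type j is Some (l, s) then `[< good z l s >] : nat
  else 0.
exists g => [|z k Kk]; last split.
- apply: continuous_to_baire => j; rewrite /g.
  case: unpickle => [[l s]|]; last exact: continuous_const.
  apply: continuous_to_nat => z; apply/emb; exists l => z' zz' /=.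
  congr nat_of_bool; apply: asbool_equiv_eq; split=> h z'' k' zz'' Kk' sk';
    apply: h => //; first exact: agree_trans (agree_sym zz') zz''.
  exact: agree_trans zz' zz''.
- case=> l [n]; rewrite /g pickleK; case: asboolP => // h _.
  by apply: h => //; rewrite size_mkseq.
- case/(oA _ _ Kk) => n h; exists n, n; rewrite /g pickleK.
  suff -> : `[< good z n (mkseq k n) >] = true by [].
  apply/asboolP => z' k' zz' Kk'; rewrite size_mkseq => /agree_mkseq kk'.
  by apply: h => //; exact: agree_sym.
Qed.

Definition functional (X : Type) (rho : baire -> X -> Prop) : Prop :=
  forall p x y, rho p x -> rho p y -> x = y.

Definition onto (X : Type) (rho : baire -> X -> Prop) : Prop :=
  forall x, exists p, rho p x.

(** The preimage of [U] is relatively open in the domain of [rho]. *)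
Definition final_open (X : Type) (rho : baire -> X -> Prop) (U : set X) : Prop :=
  forall p x, rho p x -> U x ->
  exists n, forall q y, agree n p q -> rho q y -> U y.

(** The graph of a quotient map onto [X] from a subspace of the Baire space. *)
Definition naming (X : topologicalType) (rho : baire -> X -> Prop) : Prop :=
  [/\ functional rho, onto rho & forall U, open U <-> final_open rho U].

Definition admissible_naming (X : topologicalType) (rho : baire -> X -> Prop) :
    Prop :=
  [/\ functional rho, onto rho, forall U, open U -> final_open rho U &
      forall (Z : set baire) (nu : Z -> X), continuous nu ->
        exists2 g : Z -> baire, continuous g & forall z, rho (g z) (nu z)].

Lemma continuous_naming (X Y : topologicalType) rho (f : X -> Y) :
  naming rho -> (forall U, open U -> final_open rho (f @^-1` U)) ->
  continuous f.
Proof. by move=> [_ _ rhoO] h; apply/continuousP => U /h /rhoO. Qed.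

(* Argue along a sequence (z_m, k_m) converging to (z, k) and violating openness.
   The set W m of the points x with R x k and R x k_j for all j >= m is open in X,
   because its preimage under the quotient map rho is, by compactness of the
   sequence; and these sets increase to the set of x with R x k. *)
Lemma open_on_lift (X : topologicalType) rho (K : set baire) (R : X -> set baire)
    (Z : topologicalType) (e : Z -> baire) (nu : Z -> X) :
  naming rho ->
  (forall p x k, rho p x -> K k -> R x k -> exists n, forall p' x' k',
     agree n p p' -> rho p' x' -> agree n k k' -> K k' -> R x' k') ->
  embedded e -> continuous nu -> open_on e K (fun z => R (nu z)).
Proof.
move=> [_ onto_rho rhoO] oR emb cnu z k Kk Rk; apply: contrapT => /forallNP nex.
have bad n : exists w : Z * baire, [/\ agree n (e z) (e w.1), agree n k w.2,
    K w.2 & ~ R (nu w.1) w.2].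
  apply: contrapT => /forallNP h; apply: (nex n) => z' k' zz' kk' Kk'.
  by apply: contrapT => nR; apply: (h (z', k')).
case/choice: bad => w hw.
pose W m : set X := [set x | R x k /\ forall j, m <= j -> R x (w j).2].
have openW m : open (W m).
  apply/rhoO => p x px [xk xw].
  have [n hn] := oR _ _ _ px Kk xk.
  (* Only the finitely many j below n need bounds of their own: for j >= n the point [(w j).2]
     agrees with k up to n and is covered by [hn]. *)
  have : forall j, exists N, m <= j -> forall p' x', agree N p p' -> rho p' x' ->
      R x' (w j).2.
    move=> j; case: (leqP m j) => [mj|_]; last by exists 0.
    have [_ _ Kj _] := hw j.
    have [N hN] := oR _ _ _ px Kj (xw _ mj).
    by exists N => _ p' x' pp' px'; exact: hN _ _ _ pp' px' (agree_refl _) Kj.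
  case/choice => N hN; exists (maxn n (\max_(j < n) N j)) => p' x' pp' px'.
  split; first by exact: hn _ _ _ (agree_maxl pp') px' (agree_refl _) Kk.
  move=> j mj; have [_ kj Kj _] := hw j; case: (leqP n j) => nj.
    exact: hn _ _ _ (agree_maxl pp') px' (agree_le nj kj) Kj.
  apply: hN mj _ _ _ px'; apply: agree_le (agree_maxr pp').
  exact: (@leq_bigmax _ (fun i : 'I_n => N i) (Ordinal nj)).
have [p pz] := onto_rho (nu z).
have [n hn] := oR _ _ _ pz Kk Rk.
have Wz : W n (nu z).
  split=> // j nj; have [_ kj Kj _] := hw j.
  exact: hn _ _ _ (agree_refl _) pz (agree_le nj kj) Kj.
have /emb[l hl] : nbhs z (nu @^-1` W n).
  by apply: cnu; apply: open_nbhs_nbhs.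
pose m := maxn l n; have [zm _ _ nR] := hw m; apply: nR.
have [_] := hl _ (agree_maxl zm); apply; exact: leq_maxr.
Qed.

Section opens.
Variables (X : topologicalType) (rho : baire -> X -> Prop).
Hypothesis rhoN : naming rho.

Definition saturated_code : set baire :=
  [set p | forall a b x, rho a x -> rho b x -> Ob p a -> Ob p b].

Definition coded_open (x : X) : set baire :=
  [set p | exists2 a, rho a x & Ob p a].

Lemma coded_openE p a x :
  saturated_code p -> rho a x -> coded_open x p <-> Ob p a.
Proof. by move=> Pp ax; split=> [[b bx]|]; [exact: Pp bx ax|exists a]. Qed.

(** The preimage of [U] under [rho] is open on the domain of [rho], so [open_on_code] applies to a
    family constant in its parameter; the code is read off at the zero sequence. *)
Lemma open_coded U : open U ->
  exists2 p, saturated_code p & forall x, coded_open x p <-> U x.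
Proof.
have [_ ontor rhoO] := rhoN; move=> /rhoO oU.
have oU' : open_on (fun p : baire => p) [set a | exists x, rho a x]
    (fun _ a => exists2 x, rho a x & U x).
  move=> z a _ [x ax Ux]; have [n hn] := oU _ _ ax Ux.
  by exists n => _ a' _ aa' [y a'y]; exists y => //; exact: hn _ _ aa' a'y.
have [g _ hg] := open_on_code embedded_id oU'.
have [fr _ _] := rhoN.
have H a x : rho a x -> Ob (g (fun=> 0)) a <-> U x.
  move=> ax; rewrite hg; last by exists x.
  by split=> [[y ay]|]; [rewrite (fr _ _ _ ax ay)|exists x].
exists (g (fun=> 0)) => [a b x ax bx|x]; first by move=> /(H _ _ ax) /(H _ _ bx).
split=> [[a ax /(H _ _ ax)]//|Ux]; have [a ax] := ontor x.
by exists a => //; exact/(H _ _ ax).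
Qed.

Lemma coded_open_on p x k : rho p x -> saturated_code k -> coded_open x k ->
  exists n, forall p' x' k', agree n p p' -> rho p' x' -> agree n k k' ->
    saturated_code k' -> coded_open x' k'.
Proof.
move=> px Pk /(coded_openE Pk px) /Ob_agree[n hn]; exists n.
by move=> p' x' k' pp' px' kk' _; exists p' => //; exact: hn.
Qed.

Lemma coded_open_inj x y : kolmogorov_space X ->
  (forall p, saturated_code p -> coded_open x p <-> coded_open y p) -> x = y.
Proof.
move=> /T0P T0 h; apply: T0 => U /open_coded[p Pp hp].
by rewrite -!hp; exact: h.
Qed.

End opens.

(** A name of x is a code of any open set whose trace on the test set [K] is [R x]. The standard
    admissible naming and the naming of function spaces both have this form. *)
Definition code_naming (X : Type) (K : set baire) (R : X -> set baire) :
    baire -> X -> Prop :=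
  fun p x => forall k, K k -> Ob p k <-> R x k.

(** For continuous nu the relation R (nu z) k is open on Z x K by [open_on_lift], and a continuous
    code for it is exactly a lift of nu. Surjectivity is the lifting of a constant map. *)
Lemma admissible_code_naming (X : topologicalType) rho K (R : X -> set baire) :
  naming rho ->
  (forall p x k, rho p x -> K k -> R x k -> exists n, forall p' x' k',
     agree n p p' -> rho p' x' -> agree n k k' -> K k' -> R x' k') ->
  (forall x y, (forall k, K k -> R x k <-> R y k) -> x = y) ->
  (forall U, open U -> final_open (code_naming K R) U) ->
  admissible_naming (code_naming K R).
Proof.
move=> rhoN oR inj cont.
have lift (Z : topologicalType) (e : Z -> baire) (nu : Z -> X) :
    embedded e -> continuous nu -> exists2 g : Z -> baire, continuous g &
    forall z, code_naming K R (g z) (nu z).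
  move=> emb cnu.
  have [g cg hg] := open_on_code emb (open_on_lift rhoN oR emb cnu).
  by exists g => // z k Kk; exact: hg.
split=> //; last by move=> Z nu cnu; exact: (lift _ _ _ (@embedded_val Z)).
  move=> p x y px py; apply: inj => k Kk.
  by split=> [/(px _ Kk)/(py _ Kk)|/(py _ Kk)/(px _ Kk)].
move=> x; have [g _ hg] := lift _ _ _ embedded_id (@continuous_const baire X x).
by exists (g (fun=> 0)); exact: hg.
Qed.

(** An open set U of [X] is tested by one saturated code k: a name p of x satisfies [Ob p k] exactly
    when x is in U, and this is witnessed by finitely many values of p. *)
Lemma admissible_standard (X : topologicalType) rho :
  naming rho -> kolmogorov_space X ->
  admissible_naming (code_naming (saturated_code rho) (@coded_open X rho)).
Proof.
move=> rhoN T0; apply: (admissible_code_naming rhoN).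
- exact: coded_open_on.
- by move=> x y; exact: coded_open_inj.
move=> U /(open_coded rhoN)[k Pk kU] p x px Ux.
have [n hn] := Ob_agree ((px _ Pk).2 ((kU x).2 Ux)).
exists n => q y pq qy; apply/kU/(qy _ Pk); exact: hn.
Qed.

(** The quotient map [delta] lifts continuously through [rho], so a set with open preimage under
    [rho] has open preimage under [delta] and is therefore open. *)
Lemma admissible_is_naming (X : topologicalType) (rho delta : baire -> X -> Prop) :
  naming delta -> admissible_naming rho -> naming rho.
Proof.
move=> [fd od dO] [fr orr cr ar]; split=> // U; split=> [/cr//|sU].
apply/dO => p x px Ux.
pose D := [set p | exists x, delta p x].
have nuP (d : D) : exists x, delta (set_val d) x by exact: (set_valP d).
case/choice: nuP => nu hnu.
have cnu : continuous nu.
  apply/continuousP => V oV; rewrite openE => d Vd; apply/embedded_val.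
  have /dO oV' := oV; have [n hn] := oV' _ _ (hnu d) Vd.
  by exists n => z' dz'; exact: hn _ _ dz' (hnu _).
have [g cg hg] := ar _ _ cnu.
have Dp : p \in D by apply/mem_set; exists x.
pose d : D := exist _ p Dp.
have nud : nu d = x by exact: fd (hnu d) px.
have Ud : U (nu d) by rewrite nud.
have [n hn] := sU _ _ (hg d) Ud.
have /embedded_val[m hm] := cg d _ (nbhs_agree (g d) n).
exists m => q y pq qy.
have Dq : q \in D by apply/mem_set; exists y.
pose d' : D := exist _ q Dq.
have <- : nu d' = y by exact: fd (hnu d') qy.
by apply: hn _ _ _ (hg d'); exact: hm.
Qed.

(** A copy of [X] that remembers [rho] in its type, so that the quotient topology of [rho] can be
    its canonical topology. *)
Definition final (X : Type) (rho : baire -> X -> Prop) : Type := X.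

Section final.
Variables (X : Type) (rho : baire -> X -> Prop).

Lemma final_openT : final_open rho setT.
Proof. by move=> p x _ _; exists 0. Qed.

Lemma final_openI : setI_closed (final_open rho).
Proof.
move=> U V oU oV p x px [/(oU _ _ px)[n hn] /(oV _ _ px)[m hm]].
exists (maxn n m) => q y pq qy; split.
  exact: hn _ _ (agree_maxl pq) qy.
exact: hm _ _ (agree_maxr pq) qy.
Qed.

Lemma final_open_bigU (I : Type) (f : I -> set X) :
  (forall i, final_open rho (f i)) -> final_open rho (\bigcup_i f i).
Proof.
move=> h p x px [i _ /(h i _ _ px)[n hn]].
by exists n => q y pq qy; exists i => //; exact: hn _ _ pq qy.
Qed.

HB.instance Definition _ := gen_eqMixin (final rho).
HB.instance Definition _ := gen_choiceMixin (final rho).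
HB.instance Definition _ := isOpenTopological.Build (final rho)
  final_openT final_openI final_open_bigU.

Lemma final_naming : functional rho -> onto rho -> @naming (final rho) rho.
Proof. by move=> ? ?; split. Qed.

End final.

(** * Namings of qcb0-spaces *)

Lemma second_countable_enum (Y : topologicalType) : @second_countable Y ->
  exists b : nat -> set Y, (forall n, open (b n)) /\
    forall y U, nbhs y U -> exists n, b n y /\ b n `<=` U.
Proof.
case=> B /countable_injP[f finj] [Bo Bn].
(* A base set gets its value under the injection [f] as index; indices outside the range of [f] get
   the empty set. *)
exists (fun n y => exists U, [/\ B U, f U = n & U y]); split=> [n|y U yU].
  rewrite openE => y [U [BU fU Uy]]; rewrite /interior nbhsE /=; exists U.
    by split=> //; exact: Bo.
  by move=> z Uz; exists U.
have [V [BV Vy] VU] := Bn y _ yU.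
exists (f V); split=> [|z [W [BW fW Wz]]]; first by exists V.
by apply: VU; rewrite -(finj W V _ _ fW) // inE.
Qed.

(** A name of [q y] enumerates the indices of the basic sets containing y, shifted by one so that
    the value 0 lists nothing. Points y with a common name have images in the same open sets, hence
    equal images since X is T0. *)
Lemma qcb0_naming (X : topologicalType) : qcb0 X -> exists rho, @naming X rho.
Proof.
move=> [T0 [Y [q [scY [qs qo]]]]].
have [b [bo bn]] := second_countable_enum scY.
pose names (p : baire) y := forall n, b n y <-> exists i, p i = n.+1.
exists (fun p x => exists2 y, q y = x & names p y).
split=> [p x x' [y <- yp] [y' <- yp']|x|U].
- have yy' z z' U : names p z -> names p z' -> open U -> U (q z) -> U (q z').
    move=> pz pz' /qo oU Uz.
    have [n [/pz/pz' nz' nU]] : exists n, b n z /\ b n `<=` q @^-1` U.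
      by apply: bn; apply: open_nbhs_nbhs.
    exact: nU.
  by move/T0P: T0; apply=> U oU; split; exact: yy'.
- have [y <-] := qs x.
  exists (fun i => if `[< b i y >] then i.+1 else 0), y => // n; split.
    by move=> bny; exists n; case: asboolP.
  by case=> i; case: asboolP => // bi [<-].
split=> [/qo oU p x [y <- py] Uy|h].
  have [n [/py[i pi] nU]] : exists n, b n y /\ b n `<=` q @^-1` U.
    by apply: bn; apply: open_nbhs_nbhs.
  exists i.+1 => p' x' pp' [y' <- py']; apply: nU; apply/py'.
  by exists i; rewrite -pp'.
apply/qo; rewrite openE => y Uy.
pose std (y : Y) : baire := fun i => if `[< b i y >] then i.+1 else 0.
have stdP y' n : b n y' <-> exists i, std y' i = n.+1.
  split=> [bny|[i]]; rewrite /std; last by case: asboolP => // bi [<-].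
  by exists n; case: asboolP.
have [n hn] : exists n, forall p' x', agree n (std y) p' ->
    (exists2 y', q y' = x' & names p' y') -> U x'.
  by apply: (h _ (q y)) => //; exists y => // i; exact: stdP.
pose V m := [set y' | forall i, i < m -> b i y -> b i y'].
have nV m : nbhs y (V m).
  elim: m => [|m IH]; first by apply: filterE.
  have [bm|bm] := pselect (b m y).
    have : nbhs y (b m) by apply: open_nbhs_nbhs.
    apply: filterS2 IH => y' h1 h2 i; rewrite ltnS leq_eqVlt => /orP[/eqP->//|].
    exact: h1.
  apply: filterS IH => y' h1 i; rewrite ltnS leq_eqVlt => /orP[/eqP->//|].
  exact: h1.
apply: filterS (nV n) => y' Vy'.
(* This is a name of [q y'] that starts like [std y]: its first n values list only basic sets of
   index below n around y, and these contain y' by the choice of [V n]. *)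
pose p' : baire := fun i => if i < n then std y i else std y' (i - n).
apply: (hn p'); first by move=> i ni; rewrite /p' ni.
exists y' => // k; split=> [/stdP[i ik]|[i]].
  by exists (n + i); rewrite /p' ltnNge leq_addr /= addKn.
rewrite /p'; case: ltnP => [ni|_ e]; last by apply/stdP; exists (i - n).
by rewrite /std; case: asboolP => // bi [<-]; exact: Vy'.
Qed.

Lemma second_countable_sub (D : set baire) : @second_countable (D : topologicalType).
Proof.
pose cyl (s : seq nat) : set D := [set d | mkseq (set_val d) (size s) = s].
exists (range cyl); first exact: card_le_trans (card_image_le _ _) (countableP _).
split=> [_ [s _ <-]|d U /embedded_val[n hn]].
  rewrite openE => d ds; apply/embedded_val; exists (size s) => d'.
  by move=> /agree_mkseq; rewrite /cyl /= ds => <-.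
exists (cyl (mkseq (set_val d) n)).
  by split; [exists (mkseq (set_val d) n)|rewrite /cyl /= size_mkseq].
move=> d'; rewrite /cyl /= size_mkseq => /agree_mkseq dd'.
by apply: hn; exact: agree_sym.
Qed.

Lemma naming_representation (X : topologicalType) rho :
  functional rho -> @onto X rho -> exists (D : set baire) (delta : D -> X),
    forall p x, rho p x <-> exists2 d : D, set_val d = p & delta d = x.
Proof.
move=> fr orr; pose D := [set p | exists x, rho p x].
have [delta hd] : {delta : D -> X & forall d, rho (set_val d) (delta d)}.
  have h (d : D) : exists x, rho (set_val d) x by exact: (set_valP d).
  by exists (fun d => projT1 (cid (h d))) => d; case: (cid (h d)).
exists D, delta => p x; split=> [px|[d <- <-]//].
have Dp : p \in D by apply/mem_set; exists x.
by exists (exist _ p Dp) => //; apply: fr px; exact: (hd (exist _ p Dp)).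
Qed.

Definition names_of (X : Type) (D : set baire) (delta : D -> X) :
    baire -> X -> Prop :=
  fun p x => exists2 d : D, set_val d = p & delta d = x.

Lemma set_val_inj (D : set baire) (d d' : D) : set_val d = set_val d' -> d = d'.
Proof. by case: d d' => [p Dp] [q Dq]; exact: eq_exist. Qed.

Lemma names_of_functional (X : Type) (D : set baire) (delta : D -> X) :
  functional (names_of delta).
Proof. by move=> p x y [d <- <-] [d' /set_val_inj -> <-]. Qed.

Lemma final_open_names_of (X : topologicalType) (D : set baire) (delta : D -> X)
    (U : set X) :
  final_open (names_of delta) U <-> open (delta @^-1` U).
Proof.
split=> [h|oU p x [d <- <-] Ud].
  rewrite openE => d Ud; apply/embedded_val.
  have [n hn] := h _ _ (ex_intro2 _ _ d erefl erefl) Ud.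
  by exists n => z' dz'; apply: hn dz' _; exists z'.
have /embedded_val[n hn] : nbhs d (delta @^-1` U) by apply: open_nbhs_nbhs.
by exists n => q y dq [d' d'q <-]; apply: hn; rewrite d'q.
Qed.

Lemma naming_qcb0 (X : topologicalType) rho :
  kolmogorov_space X -> @naming X rho -> qcb0 X.
Proof.
move=> T0 [fr orr oU]; split=> //.
have [D [delta hd]] := naming_representation fr orr.
exists D, delta; split; first exact: second_countable_sub.
split=> [x|U].
  by have [p /hd[d _ dx]] := orr x; exists d.
rewrite -final_open_names_of.
suff -> : names_of delta = rho by exact: oU.
by apply/funext => p; apply/funext => x; apply/propext; rewrite hd.
Qed.

Lemma second_countable_qcb0 (X : topologicalType) :
  kolmogorov_space X -> @second_countable X -> qcb0 X.
Proof.
by move=> T0 sc; split=> //; exists X, (fun x => x); split=> //; split=> // x; exists x.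
Qed.

Definition EQn (X : Type) (rho : baire -> X -> Prop) : set (baire * baire) :=
  [set pq | exists2 x, rho pq.1 x & rho pq.2 x].

Lemma EQ_names_of (X : Type) (D : set baire) (delta : D -> X) :
  EQ delta = EQn (names_of delta).
Proof.
apply/seteqP; split=> [pq [p [q [hp hq e]]]|pq [x [p hp px] [q hq qx]]].
  by exists (delta p); [exists p|exists q].
by exists p, q; split=> //; rewrite px qx.
Qed.

Lemma admissible_names_of (X : topologicalType) (D : set baire) (delta : D -> X) :
  admissible delta <-> admissible_naming (names_of delta).
Proof.
split=> [[os cd ad]|[_ os cd ad]]; split=> //.
- exact: names_of_functional.
- by move=> x; have [d dx] := os x; exists (set_val d); exists d.
- by move=> U oU; apply/final_open_names_of; move/continuousP: cd; exact.
- by move=> x; have [p [d _ dx]] := os x; exists d.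
- by apply/continuousP => U /cd/final_open_names_of.
Qed.

Definition projective (X : topologicalType) (A : set X) : Prop :=
  exists n, Sigma1 n A.

Lemma QCB0_PP (X : topologicalType) : QCB0_P X <->
  qcb0 X /\ exists2 rho, @admissible_naming X rho & projective (EQn rho).
Proof.
split=> [[n [qX [D [delta [ad Sd]]]]]|[qX [rho adr [n Sn]]]].
  split=> //; exists (names_of delta); first exact/admissible_names_of.
  by exists n; rewrite -EQ_names_of.
exists n; split=> //.
have [fr orr _ _] := adr.
have [D [delta hd]] := naming_representation fr orr.
have e : names_of delta = rho.
  by apply/funext => p; apply/funext => x; apply/propext; rewrite hd.
by exists D, delta; split; [apply/admissible_names_of; rewrite e|rewrite EQ_names_of e].
Qed.

Lemma admissible_qcb0_naming (X : topologicalType) rho :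
  qcb0 X -> @admissible_naming X rho -> naming rho.
Proof. by move=> /qcb0_naming[delta nd]; exact: admissible_is_naming nd. Qed.

(** * Projective sets *)

Lemma Sigma1_preimage n (X Y : topologicalType) (f : X -> Y) (A : set Y) :
  continuous f -> Sigma1 n A -> Sigma1 n (f @^-1` A).
Proof.
elim: n X Y f A => [|n IH] X Y f A cf /=.
  case=> U [V [oU oV ->]]; exists (fun i => f @^-1` U i), (fun i => f @^-1` V i).
  move/continuousP: cf => cf; split=> // i; exact: cf.
case=> B SB ->; exists [set z | B (z.1, f z.2)]; last by [].
have c : continuous (fun z : baire * X => (z.1, f z.2)).
  apply: continuous_pair; first exact: continuous_fst.
  exact: (continuous_compose (@continuous_snd _ _) cf).
exact: (IH _ _ _ _ c SB).
Qed.

Lemma Sigma1_0U (X : topologicalType) (A B : set X) :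
  Sigma1 0 A -> Sigma1 0 B -> Sigma1 0 (A `|` B).
Proof.
move=> [U [V [oU oV ->]]] [U' [V' [oU' oV' ->]]].
exists (fun i => if odd i then U i./2 else U' i./2).
exists (fun i => if odd i then V i./2 else V' i./2).
split=> [i|i|]; try by case: ifP.
apply/seteqP; split=> [x [[i _ h]|[i _ h]]|x [i _]].
- by exists (i.*2.+1) => //=; rewrite odd_double /= uphalf_double.
- by exists (i.*2) => //=; rewrite odd_double /= doubleK.
- by case: ifP => _ h; [left|right]; exists i./2.
Qed.

Lemma Sigma1_0I (X : topologicalType) (A B : set X) :
  Sigma1 0 A -> Sigma1 0 B -> Sigma1 0 (A `&` B).
Proof.
move=> [U [V [oU oV ->]]] [U' [V' [oU' oV' ->]]].
pose sel (T : Type) (f : nat -> nat -> set T) i : set T :=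
  if @unpickle (nat * nat)%type i is Some (j, k) then f j k else set0.
exists (sel _ (fun j k => U j `&` U' k)), (sel _ (fun j k => V j `|` V' k)).
split=> [i|i|].
- by rewrite /sel; case: unpickle => [[j k]|]; [exact: openI|exact: open0].
- by rewrite /sel; case: unpickle => [[j k]|]; [exact: openU|exact: open0].
apply/seteqP; split=> [x [[j _ [Uj nVj]] [k _ [Uk nVk]]]|x [i _]].
  exists (pickle (j, k)) => //; rewrite /sel pickleK; split=> //.
  by case.
rewrite /sel; case: unpickle => [jk|[]//]; case: jk => j k [[Uj Uk] nV].
by split; [exists j => //; split=> // v; apply: nV; left|
  exists k => //; split=> // v; apply: nV; right].
Qed.

Lemma Sigma1_open (X : topologicalType) (U : set X) : open U -> Sigma1 0 U.
Proof.
move=> oU; exists (fun=> U), (fun=> set0); split=> // [i|]; first exact: open0.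
by rewrite setD0; apply/seteqP; split=> [x|x []//]; exists 0.
Qed.

Lemma Sigma1_closed (X : topologicalType) (U : set X) : open U -> Sigma1 0 (~` U).
Proof.
move=> oU; exists (fun=> setT), (fun=> U); split=> // [i|]; first exact: openT.
by rewrite setTD; apply/seteqP; split=> [x|x []//]; exists 0.
Qed.

Lemma continuous_dup (X : topologicalType) (f : baire -> baire) :
  continuous f -> continuous (fun z : baire * X => (f z.1, z.2)).
Proof.
move=> cf; apply: continuous_pair; last exact: continuous_snd.
exact: (continuous_compose (@continuous_fst _ _) cf).
Qed.

(** Both claims go through one induction, because the complement in the definition of [Sigma1]
    exchanges union and intersection. For intersections the two projected coordinates are packed
    into one. *)
Lemma Sigma1_setUI n (X : topologicalType) (A B : set X) :
  Sigma1 n A -> Sigma1 n B -> Sigma1 n (A `|` B) /\ Sigma1 n (A `&` B).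
Proof.
elim: n X A B => [|n IH] X A B.
  by move=> sA sB; split; [exact: Sigma1_0U|exact: Sigma1_0I].
move=> [A' sA' ->] [B' sB' ->].
pose pre f (C : set (baire * X)) := [set z | C (f z.1, z.2)] : set (baire * X).
have sp f C : continuous f -> Sigma1 n (~` C) -> Sigma1 n (~` pre f C).
  by move=> cf; exact: (Sigma1_preimage (continuous_dup cf)).
split.
  exists (A' `|` B'); first by rewrite setCU; case: (IH _ _ _ sA' sB').
  by apply/seteqP; split=> [x [[p]|[p]]|x [p [h|h]]];
    [exists p; left|exists p; right|left; exists p|right; exists p].
exists (pre part1 A' `&` pre part2 B').
  by rewrite setCI; case: (IH _ _ _ (sp _ _ continuous_part1 sA')
                                    (sp _ _ continuous_part2 sB')).
apply/seteqP; split=> [x [[p Ap] [q Bq]]|x [p [Ap Bp]]].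
  by exists (pair2 p q); split; rewrite /pre /= ?part1_pair ?part2_pair.
by split; [exists (part1 p)|exists (part2 p)].
Qed.

(* The index i of a member U i \ V i of the union is absorbed in the projected
   coordinate. *)
Lemma Sigma1_0_projection (X : topologicalType) (U V : nat -> set X) :
  (forall i, open (U i)) -> (forall i, open (V i)) ->
  exists U' V' : set (baire * X), [/\ open U', open V' &
    forall A, A = \bigcup_i (U i `\` V i) ->
      A = [set x | exists p : baire, (U' `\` V') (p, x)]].
Proof.
move=> oU oV; exists [set z | U (z.1 0) z.2], [set z | V (z.1 0) z.2].
have o (W : nat -> set X) : (forall i, open (W i)) ->
    open [set z : baire * X | W (z.1 0) z.2].
  move=> oW; rewrite openE => -[p x] /= Wx; rewrite /interior.
  exists ([set q : baire | q 0 = p 0], W (p 0)).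
    split=> /=; last exact: open_nbhs_nbhs.
    by apply: (@continuous_eval 0 p [set p 0]); exact/nbhs_nat.
  by move=> [q y] /= [-> ].
split; [exact: o|exact: o|move=> A ->].
apply/seteqP; split=> [x [i _ h]|x [p h]]; last by exists (p 0).
by exists (fun=> i).
Qed.

(** At level zero the set is a projection of a single difference of open sets, whose complement is
    the union of a closed and an open set; the higher levels follow by induction. *)
Lemma Sigma1S n (X : topologicalType) (A : set X) :
  Sigma1 n A -> Sigma1 n.+1 A.
Proof.
elim: n X A => [|n IH] X A; last by case=> B /IH sB ->; exists B.
case=> U [V [oU oV eA]].
have [U' [V' [oU' oV' h]]] := Sigma1_0_projection oU oV.
exists (U' `\` V'); last exact: h.
rewrite setDE setCI setCK; apply: Sigma1_0U; first exact: Sigma1_closed.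
exact: Sigma1_open.
Qed.

Lemma Sigma1_le m n (X : topologicalType) (A : set X) :
  m <= n -> Sigma1 m A -> Sigma1 n A.
Proof.
move=> /subnK <- sA; elim: (n - m) => [//|k IH]; exact: Sigma1S.
Qed.

(** The complement is a projection along a dummy coordinate. *)
Lemma Sigma1C n (X : topologicalType) (A : set X) :
  Sigma1 n A -> Sigma1 n.+1 (~` A).
Proof.
move=> sA; exists [set z | ~ A z.2].
  have := Sigma1_preimage (@continuous_snd baire X) sA.
  congr Sigma1; apply/seteqP; split=> z /=; first by move=> Az; apply.
  exact: contrapT.
by apply/seteqP; split=> [x nA|x [p]//]; exists (fun=> 0).
Qed.

(** * Projective sets under connectives and quantifiers *)

Section projective.
Variable X : topologicalType.
Implicit Types A B : set X.

Lemma projective_ext A B : (forall x, A x <-> B x) -> projective B -> projective A.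
Proof. by move=> h; suff -> : A = B by []; apply/seteqP; split=> x /h. Qed.

Lemma projectiveC A : projective A -> projective (fun x => ~ A x).
Proof. by case=> n /Sigma1C h; exists n.+1. Qed.

Lemma projectiveI A B : projective A -> projective B ->
  projective (fun x => A x /\ B x).
Proof.
move=> [n sA] [m sB]; exists (maxn n m).
by case: (Sigma1_setUI (Sigma1_le (leq_maxl n m) sA) (Sigma1_le (leq_maxr n m) sB)).
Qed.

Lemma projective_imply A B : projective A -> projective B ->
  projective (fun x => A x -> B x).
Proof.
move=> pA pB; apply: (projective_ext (B := fun x => ~ (A x /\ ~ B x))).
  move=> x; split=> [h [/h]//|h Ax]; apply: contrapT => nB; exact: h.
by apply: projectiveC; apply: projectiveI => //; exact: projectiveC.
Qed.

Lemma projective_iff A B : projective A -> projective B ->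
  projective (fun x => A x <-> B x).
Proof. by move=> pA pB; apply: projectiveI; exact: projective_imply. Qed.

Lemma projective_open A : open A -> projective A.
Proof. by move=> oA; exists 0; exact: Sigma1_open. Qed.

Lemma projective_true (P : Prop) : projective (fun _ : X => P).
Proof.
have [h|h] := pselect P.
  by apply: (projective_ext (B := setT)) => //; apply: projective_open; exact: openT.
by apply: (projective_ext (B := set0)) => //; apply: projective_open; exact: open0.
Qed.

End projective.

Section projective_quantifiers.
Variable X : topologicalType.

Lemma projective_exists (A : baire -> set X) :
  projective (fun z : baire * X => A z.1 z.2) ->
  projective (fun x => exists p, A p x).
Proof.
(* One level pays for the complement built into the definition, the other for the projection. *)
case=> n /Sigma1C h; exists n.+2; exists [set z | A z.1 z.2] => //.
Qed.

Lemma projective_forall (A : baire -> set X) :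
  projective (fun z : baire * X => A z.1 z.2) ->
  projective (fun x => forall p, A p x).
Proof.
move=> pA.
have := projectiveC (projective_exists (A := fun p x => ~ A p x) (projectiveC pA)).
apply: projective_ext => x; split=> [h [p]//|h p]; apply: contrapT => nA; apply: h; by exists p.
Qed.

Lemma projective_finite_forall (I : finType) (A : I -> set X) :
  (forall i, projective (A i)) -> projective (fun x => forall i, A i x).
Proof.
move=> pA; apply: (projective_ext (B := fun x => forall i, i \in enum I -> A i x)).
  by move=> x; split=> h i; [move=> _; exact: h|apply: h; rewrite mem_enum].
elim: (enum I) => [|j s IH].
  by apply: (projective_ext (B := fun=> True)) => //; exact: projective_true.
apply: projective_ext (projectiveI (pA j) IH) => x; split=> [h|[h1 h2] i].
  by split=> [|i si]; apply: h; rewrite inE ?eqxx ?si ?orbT.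
by rewrite inE => /orP[/eqP->|/h2].
Qed.

Lemma projective_finite_exists (I : finType) (A : I -> set X) :
  (forall i, projective (A i)) -> projective (fun x => exists i, A i x).
Proof.
move=> pA.
have /projectiveC := projective_finite_forall (fun i => projectiveC (pA i)).
apply: projective_ext => x; split=> [[i Ai] h|h]; first exact: h Ai.
by apply: contrapT => /forallNP.
Qed.

End projective_quantifiers.

Lemma projective_preimage (X Y : topologicalType) (f : X -> Y) (A : set Y) :
  continuous f -> projective A -> projective (fun x => A (f x)).
Proof. by move=> cf [n sA]; exists n; exact: Sigma1_preimage. Qed.

Lemma open_Ob : open [set z : baire * baire | Ob z.1 z.2].
Proof.
rewrite openE => -[p k] /= /Ob_agree[n hn]; rewrite /interior.
exists (agree n p, agree n k); first by split; exact: nbhs_agree.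
by move=> [p' k'] /= [? ?]; exact: hn.
Qed.

(** * Spaces with a projective kernel *)

Ltac solve_continuous :=
  lazymatch goal with
  | |- continuous (fun z => z) => exact: continuous_ident
  | |- continuous (fun _ => ?c) => exact: continuous_const
  | |- continuous (fun z => (@?f z, @?g z)) =>
      apply: (@continuous_pair _ _ _ f g); solve_continuous
  | |- continuous (fun z => fst (@?f z)) =>
      apply: (@continuous_compose _ _ _ f); [solve_continuous|exact: continuous_fst]
  | |- continuous (fun z => snd (@?f z)) =>
      apply: (@continuous_compose _ _ _ f); [solve_continuous|exact: continuous_snd]
  | |- continuous (fun z => part1 (@?f z)) =>
      apply: (@continuous_compose _ _ _ f); [solve_continuous|exact: continuous_part1]
  | |- continuous (fun z => part2 (@?f z)) =>
      apply: (@continuous_compose _ _ _ f); [solve_continuous|exact: continuous_part2]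
  | |- continuous (fun z => slice ?i (@?f z)) =>
      apply: (@continuous_compose _ _ _ f); [solve_continuous|exact: continuous_slice]
  | |- continuous (fun z => tailB (@?f z)) =>
      apply: (@continuous_compose _ _ _ f); [solve_continuous|exact: continuous_tail]
  | |- continuous (fun z => consB ?i (@?f z)) =>
      apply: (@continuous_compose _ _ _ f); [solve_continuous|exact: continuous_cons]
  | |- continuous (fun z => pair2 (@?f z) (@?g z)) =>
      apply: (@continuous_pair2 _ f g); solve_continuous
  end.

Lemma projective_Ob : projective [set z : baire * baire | Ob z.1 z.2].
Proof. exact: projective_open open_Ob. Qed.

(** Projectivity is read off the shape of the predicate: connectives and quantifiers over the Baire
    space or a finite type are peeled off, and atoms are continuous preimages of sets known to be
    projective. *)
Ltac solve_projective :=
  cbv beta;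
  lazymatch goal with
  | |- projective (fun z => (@?A z) /\ (@?B z)) =>
      apply: (@projectiveI _ A B); solve_projective
  | |- projective (fun z => (@?A z) <-> (@?B z)) =>
      apply: (@projective_iff _ A B); solve_projective
  | |- projective (fun z => exists p : baire, @?A z p) =>
      apply: (@projective_exists _ (fun u v => A v u)); solve_projective
  | |- projective (fun z => forall p : baire, @?A z p) =>
      apply: (@projective_forall _ (fun u v => A v u)); solve_projective
  | |- projective (fun z => exists i : Finite.sort _, @?A z i) =>
      apply: (@projective_finite_exists _ _ (fun u v => A v u)) => ?; solve_projective
  | |- projective (fun z => forall i : Finite.sort _, @?A z i) =>
      apply: (@projective_finite_forall _ _ (fun u v => A v u)) => ?; solve_projective
  | |- projective (fun z => (@?A z) -> (@?B z)) =>
      apply: (@projective_imply _ A B); solve_projective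
  | |- projective (fun z => Ob (@?f z) (@?g z)) =>
      apply: (@projective_preimage _ _ (fun u => (f u, g u)) _ _ projective_Ob);
      cbv beta; solve_continuous
  | |- projective (fun z => EQn ?rho (@?f z, @?g z)) =>
      apply: (@projective_preimage _ _ (fun u => (f u, g u)) (EQn rho));
      [cbv beta; solve_continuous|by eauto]
  | |- projective (fun z => ?A (@?f z)) =>
      apply: (@projective_preimage _ _ f A);
      [cbv beta; solve_continuous|by eauto]
  end.

Lemma EQn_named (X : Type) (rho : baire -> X -> Prop) p :
  EQn rho (p, p) <-> exists x, rho p x.
Proof. by split=> [[x px _]|[x px]]; exists x. Qed.

Lemma projective_saturated (X : topologicalType) (rho : baire -> X -> Prop) :
  projective (EQn rho) -> projective (saturated_code rho).
Proof.
move=> pE; apply: (projective_ext (B := fun p : baire => forall a b : baire,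
    EQn rho (a, b) -> Ob p a -> Ob p b)).
  move=> p; split=> [h a b [x ax bx]|h a b x ax bx]; first exact: h ax bx.
  by apply: h; exists x.
solve_projective.
Qed.

(** Points are eliminated from the kernel of the standard naming: x is replaced by one of its
    [rho]-names a, and for saturated p membership of x in the open set of p becomes [Ob p a]. *)
Lemma QCB0_P_naming (X : topologicalType) rho :
  kolmogorov_space X -> @naming X rho -> projective (EQn rho) -> QCB0_P X.
Proof.
move=> T0 nr pE; apply/QCB0_PP; split; first exact: naming_qcb0 nr.
exists (code_naming (saturated_code rho) (@coded_open X rho)).
  exact: admissible_standard.
apply: (projective_ext (B := fun qq : baire * baire =>
    exists a : baire, EQn rho (a, a) /\ forall p : baire, saturated_code rho p ->
      (Ob qq.1 p <-> Ob p a) /\ (Ob qq.2 p <-> Ob p a))).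
  have H a x p : saturated_code rho p -> rho a x -> coded_open rho x p <-> Ob p a.
    exact: coded_openE.
  have [_ orr _] := nr.
  move=> [q q'] /=; split=> [[x qx q'x]|[a [[x ax _] h]]].
    have [a ax] := orr x; exists a; split; first by exists x.
    by move=> p Pp; rewrite -(H a x) //; split; [exact: qx|exact: q'x].
  by exists x => p Pp; rewrite (H a x) //; case: (h p Pp).
have pS := projective_saturated pE.
solve_projective.
Qed.

(** Continuous maps become points of the Baire space: by [open_on_lift], having f x in the open set
    coded by p is an open condition on a name of x together with p. This gives projective
    definitions a parameter for [f], and names to all points of the exponential. *)
Lemma code_map (X Y : topologicalType) rhoX rhoY (f : X -> Y) :
  @naming X rhoX -> @naming Y rhoY -> continuous f ->
  exists c : baire, forall (k : baire) x, rhoX (part1 k) x -> saturated_code rhoY (part2 k) ->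
    Ob c k <-> coded_open rhoY (f x) (part2 k).
Proof.
move=> nX nY cf; have [fX oX XO] := nX.
have [D [delta hd]] := naming_representation fX oX.
have cdelta : continuous delta.
  apply/continuousP => U /XO; suff -> : rhoX = names_of delta.
    by move/final_open_names_of.
  by apply/funext => p; apply/funext => x; apply/propext; rewrite hd.
have cfd : continuous (fun d => f (delta d)) := continuous_compose cdelta cf.
have H := open_on_lift nY (coded_open_on (rho := rhoY)) (@embedded_val D) cfd.
pose A (k : baire) := exists2 x, rhoX (part1 k) x & coded_open rhoY (f x) (part2 k).
have oA : open_on (fun p : baire => p)
    [set k | (exists x, rhoX (part1 k) x) /\ saturated_code rhoY (part2 k)]
    (fun _ => A).
  move=> z k [_ Pk] [x /hd[d dk <-] Ax].
  have [n hn] := H _ _ Pk Ax.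
  have [m1 h1] := continuous_agree k n continuous_part1.
  have [m2 h2] := continuous_agree k n continuous_part2.
  exists (maxn m1 m2) => _ k' _ kk' [[x' x'k'] Pk'].
  exists x' => //; have /hd[d' d'k' <-] := x'k'.
  apply: hn Pk'; last exact: h2 (agree_maxr kk').
  by rewrite dk d'k'; exact: h1 (agree_maxl kk').
have [g _ hg] := open_on_code embedded_id oA.
exists (g (fun=> 0)) => k x kx Pk; rewrite hg; last by split=> //; exists x.
by split=> [[y ky]|]; [rewrite (fX _ _ _ kx ky)|exists x].
Qed.

Definition graph_names (X Y : Type) (rhoX : baire -> X -> Prop)
    (rhoY : baire -> Y -> Prop) (f : X -> Y) : set (baire * baire) :=
  [set ab | exists2 x, rhoX ab.1 x & rhoY ab.2 (f x)].

(** Since [Y] is T0, f x is the point named by b as soon as both lie in the same coded open sets.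
    With the code c of [f] as a parameter this is a quantification over saturated codes. *)
Lemma projective_graph (X Y : topologicalType) rhoX rhoY (f : X -> Y) :
  kolmogorov_space Y -> @naming X rhoX -> @naming Y rhoY -> continuous f ->
  projective (EQn rhoX) -> projective (EQn rhoY) ->
  projective (graph_names rhoX rhoY f).
Proof.
move=> T0 nX nY cf pX pY; have [c hc] := code_map nX nY cf.
apply: (projective_ext (B := fun ab : baire * baire =>
  EQn rhoX (ab.1, ab.1) /\ EQn rhoY (ab.2, ab.2) /\
  forall p : baire, saturated_code rhoY p -> Ob c (pair2 ab.1 p) <-> Ob p ab.2)).
  have H a x p : rhoX a x -> saturated_code rhoY p ->
      Ob c (pair2 a p) <-> coded_open rhoY (f x) p.
    by move=> ax Pp; rewrite (hc _ x) ?part1_pair ?part2_pair.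
  move=> [a b] /=; split=> [[x ax bfx]|[[x ax _] [[y by_ _] h]]].
    split; first by exists x.
    split; first by exists (f x).
    by move=> p Pp; rewrite (H _ _ _ ax Pp); exact: coded_openE.
  exists x => //; suff -> : f x = y by [].
  apply: (coded_open_inj nY T0) => p Pp.
  by rewrite -(H _ _ _ ax Pp) h // (coded_openE Pp by_).
have pS := projective_saturated pY.
solve_projective.
Qed.

(** * The discrete space of natural numbers and the Sierpinski space *)

Lemma nat_T0 : kolmogorov_space nat.
Proof.
apply/T0P => x y h; apply/esym.
have o : open [set x] by rewrite openE => z ->; exact/nbhs_nat.
by apply/(h _ o).
Qed.

Lemma QCB0_P_nat : QCB0_P nat.
Proof.
apply: (@QCB0_P_naming _ (fun p n => p 0 = n)); first exact: nat_T0.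
- split=> [p x y <- <- //|n|U]; first by exists (fun=> n).
  split=> [_ p n pn Un|_].
    by exists 1 => q m pq <-; rewrite -(pq 0) // pn.
  by rewrite openE => n Un; exact/nbhs_nat.
apply: projective_open; rewrite openE => -[p q] [n /= pn qn]; rewrite /interior.
exists (agree 1 p, agree 1 q); first by split; exact: nbhs_agree.
move=> [p' q'] /= [pp' qq'].
by exists n; rewrite /= ?pn ?qn -?(pp' 0) -?(qq' 0).
Qed.

Lemma sierpinski_openE (U : set sierpinski) : open U <-> (U false -> U true).
Proof. exact: sierpinski_openP. Qed.

Definition nonzero (p : baire) : Prop := exists n, p n != 0.

Lemma open_nonzero : open (nonzero : set baire).
Proof.
rewrite openE => p [n pn]; apply/nbhs_baireP; exists n.+1 => q pq.
by exists n; rewrite -pq.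
Qed.

Lemma sierpinski_T0 : kolmogorov_space sierpinski.
Proof.
apply/T0P => x y h.
have o : open ([set true] : set sierpinski) by apply/sierpinski_openE.
by have := h _ o; case: x y {h} => -[] //= [a b]; [rewrite a|rewrite b].
Qed.

Lemma QCB0_P_sierpinski : QCB0_P sierpinski.
Proof.
have dec p (b : sierpinski) : (nonzero p <-> b = true) <-> b = `[< nonzero p >].
  by case: asboolP => h; case: b; split=> // -[h1 h2]; [have := h1 h|have := h (h2 erefl)].
apply: (@QCB0_P_naming _ (fun p (b : sierpinski) => nonzero p <-> b = true)).
- exact: sierpinski_T0.
- split=> [p x y /dec -> /dec -> //|b|U].
    exists (fun=> (b : bool) : nat); split=> [[_]|->]; last by exists 0.
    by case: b.
  rewrite sierpinski_openE; split=> [h p b pb Ub|h Uf].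
    have Ut : U true by case: b pb Ub => // _ /h.
    have [nz|nz] := pselect (nonzero p).
      have /nbhs_baireP[n hn] : nbhs p nonzero.
        by apply: open_nbhs_nbhs; split=> //; exact: open_nonzero.
      by exists n => q y /hn qz /iffLR -> .
    by exists 0 => q [] // _ _; case: b pb Ub => // -[_ /(_ erefl)].
  have [n hn] : exists n, forall q y, agree n (fun=> 0) q ->
      (nonzero q <-> y = true) -> U y.
    by apply: (h _ false) => //; split=> // -[].
  (* Every cylinder around the zero sequence, a name of bottom, contains a name of top: here the
     sequence whose only nonzero value is at n. *)
  apply: (hn (fun i => i == n)) => [i ni|]; first by rewrite ltn_eqF.
  by split=> // _; exists n; rewrite eqxx.
have pN : projective (nonzero : set baire) by exact: projective_open open_nonzero.
apply: (projective_ext (B := fun z : baire * baire => nonzero z.1 <-> nonzero z.2)).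
  move=> [p q]; split=> [[b /= -> ->]//|/= pq].
  by exists `[< nonzero p >] => /=; [|rewrite -pq]; apply/dec.
solve_projective.
Qed.

(** * Finite limits *)

Lemma admissible_realizer (Z X : topologicalType) rhoZ rhoX (f : Z -> X) :
  @naming Z rhoZ -> @admissible_naming X rhoX -> continuous f ->
  exists h : baire -> baire, (forall a z, rhoZ a z -> rhoX (h a) (f z)) /\
    forall a z n, rhoZ a z -> exists m, forall a' z', agree m a a' ->
      rhoZ a' z' -> agree n (h a) (h a').
Proof.
move=> [fZ oZ ZO] [_ _ _ adm] cf.
have [D [delta hd]] := naming_representation fZ oZ.
have eD : rhoZ = names_of delta.
  by apply/funext => p; apply/funext => x; apply/propext; rewrite hd.
have cdelta : continuous delta.
  by apply/continuousP => U /ZO; rewrite eD => /final_open_names_of.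
have [g cg hg] := adm _ _ (continuous_compose cdelta cf).
(* Outside the domain of [rhoZ] the value is arbitrary, since continuity is claimed only along
   names. *)
pose h a : baire := if pselect (exists d : D, set_val d = a) is left e
  then g (projT1 (cid e)) else a.
have hE d : h (set_val d) = g d.
  rewrite /h; case: pselect => [e|[]]; last by exists d.
  by congr g; apply: set_val_inj; case: (cid e).
exists h; split=> [a z /hd[d <- <-]|a z n /hd[d <- _]]; first by rewrite hE.
have /embedded_val[m hm] := cg d _ (nbhs_agree (g d) n).
exists m => a' z' ad /hd[d' d'a' _]; rewrite -d'a' !hE.
by apply: hm; rewrite d'a'.
Qed.

(** The first n values of a join use finitely many values of the slices, so one bound serves all
    slices. *)
Lemma agree_join (I : countType) n : exists N, forall f g : I -> baire,
  (forall i, agree N (f i) (g i)) -> agree n (join f) (join g).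
Proof.
elim: n => [|n [N IH]]; first by exists 0.
pose k := if @unpickle (I * nat)%type n is Some (_, k) then k.+1 else 0.
exists (maxn N k) => f g h i; rewrite ltnS leq_eqVlt => /orP[/eqP ->|].
  rewrite /join; move: (erefl k); rewrite {1}/k.
  case: unpickle => // -[j l] ek; apply: (h j).
  by rewrite leq_max -ek ltnSn orbT.
by apply: IH => j; exact: agree_maxl (h j).
Qed.

Lemma finite_bound (I : finType) (P : I -> nat -> Prop) :
  (forall i m n, m <= n -> P i m -> P i n) -> (forall i, exists n, P i n) ->
  exists n, forall i, P i n.
Proof.
move=> mono /choice[N hN]; exists (\max_i N i) => i.
by apply: mono (hN i); exact: leq_bigmax.
Qed.

Section limits.
Variables (J : fincat) (F : diagram J) (rho : forall i, baire -> F i -> Prop).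
Hypotheses (T0F : forall i, kolmogorov_space (F i))
  (adm : forall i, admissible_naming (@rho i))
  (nam : forall i, naming (@rho i))
  (pE : forall i, projective (EQn (@rho i))).

Definition limit_points : Type :=
  {x : forall i, F i | forall (i j : J) (u : fhom i j), dmap u (x i) = x j}.

Definition limit_point (x : forall i, F i)
    (h : forall (i j : J) (u : fhom i j), dmap u (x i) = x j) : limit_points :=
  exist _ x h.

(** A name bundles names of all components. The quotient topology it induces may be finer than the
    subspace topology of the Tychonoff product. *)
Definition limit_names (p : baire) (x : limit_points) : Prop :=
  forall i, rho (slice i p) (sval x i).

Definition limit_space : topologicalType := final limit_names.

Definition limit_proj (i : J) (x : limit_space) : F i := sval (x : limit_points) i.

Lemma limit_points_eq (x y : limit_points) :
  (forall i, sval x i = sval y i) -> x = y.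
Proof. by case: x y => [x hx] [y hy] h; apply: eq_exist; exact: functional_extensionality_dep. Qed.

Lemma limit_names_functional : functional limit_names.
Proof.
move=> p x y px py; apply: limit_points_eq => i.
by have [fr _ _] := nam i; exact: fr (px i) (py i).
Qed.

Lemma limit_names_onto : onto limit_names.
Proof.
move=> x; have h i : exists p, rho p (sval x i).
  by have [_ orr _] := nam i; exact: orr.
exists (join (fun i => projT1 (cid (h i)))) => i.
by rewrite slice_join; case: (cid (h i)).
Qed.

Lemma limit_naming : @naming limit_space limit_names.
Proof. exact: final_naming limit_names_functional limit_names_onto. Qed.

Lemma limit_proj_continuous i : continuous (@limit_proj i).
Proof.
apply: (continuous_naming limit_naming) => U.
have [_ _ rO] := nam i; move=> /rO oU p x px Ux.
have [n hn] := oU _ _ (px i) Ux.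
have [m hm] := continuous_agree p n (continuous_slice (i := i)).
by exists m => q y /hm pq qy; exact: hn _ _ pq (qy i).
Qed.

Lemma limit_T0 : kolmogorov_space limit_space.
Proof.
apply/T0P => x y h; apply: limit_points_eq => i.
apply: ((T0P _).1 (@T0F i)) => U oU; apply: (h (@limit_proj i @^-1` U)).
by move/continuousP: (@limit_proj_continuous i); exact.
Qed.

(** Compatibility is expressed by the graphs of the diagram maps, and only for p, because the slices
    of q name the same components. *)
Lemma limit_projective : projective (EQn limit_names).
Proof.
apply: (projective_ext (B := fun pq : baire * baire =>
  (forall i : J, EQn (@rho i) (slice i pq.1, slice i pq.2)) /\
  forall i j : J, forall u : fhom i j,
    graph_names (@rho i) (@rho j) (dmap u) (slice i pq.1, slice j pq.1))).
  move=> [p q]; split=> [[x px qx]|[h c]].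
    split=> [i|i j u]; first by exists (sval x i); [exact: px|exact: qx].
    exists (sval x i); first exact: px.
    by rewrite (proj2_sig x); exact: px.
  pose x i := projT1 (cid2 (h i)).
  have px i : rho (slice i p) (x i) by rewrite /x; case: cid2.
  have qx i : rho (slice i q) (x i) by rewrite /x; case: cid2.
  have xc i j (u : fhom i j) : dmap u (x i) = x j.
    have [y py pj] := c i j u; have [fi _ _] := nam i; have [fj _ _] := nam j.
    by rewrite (fi _ _ _ (px i) py); exact: fj pj (px j).
  by exists (exist _ x xc).
apply: projectiveI.
  apply: projective_finite_forall => i.
  apply: (projective_preimage (f := fun u => (slice i u.1, slice i u.2))) (pE i).
  solve_continuous.
apply: projective_finite_forall => i; apply: projective_finite_forall => j.
apply: projective_finite_forall => u.
apply: (projective_preimage (f := fun u => (slice i u.1, slice j u.1))).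
  solve_continuous.
by apply: projective_graph => //; exact: dmap_continuous.
Qed.

(** Admissibility turns each leg of a cone into a map on names, and the join of these maps realizes
    the mediating map. Finiteness of [J] yields a common modulus of continuity. *)
Lemma limit_spaceP : is_limit limit_proj.
Proof.
split; first exact: naming_qcb0 limit_T0 limit_naming.
  split; first exact: limit_proj_continuous.
  by move=> i j u x; exact: (proj2_sig x).
move=> Z tau /qcb0_naming[rhoZ nZ] [ctau tauM].
pose f z : limit_space :=
  limit_point (x := fun i => tau i z) (fun i j u => tauM i j u z).
exists f; split; last first.
  by move=> g [_ hg]; apply/funext => z; apply: limit_points_eq => i /=; rewrite -hg.
split=> //; apply: (continuous_naming nZ) => U oU a z az Uz.
have /choice[h hh] : forall i, exists h : baire -> baire,
    (forall a z, rhoZ a z -> rho (h a) (tau i z)) /\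
    forall a z n, rhoZ a z -> exists m, forall a' z', agree m a a' ->
      rhoZ a' z' -> agree n (h a) (h a').
  by move=> i; exact: admissible_realizer nZ (adm i) (ctau i).
have hf a' z' : rhoZ a' z' -> limit_names (join (fun i => h i a')) (f z').
  by move=> a'z' i; rewrite slice_join; exact: (proj1 (hh i)).
have [n hn] := oU _ _ (hf _ _ az) Uz.
have [N hN] := agree_join J n.
have [m hm] : exists m, forall i, forall a' z', agree m a a' -> rhoZ a' z' ->
    agree N (h i a) (h i a').
  apply: finite_bound => [i k l kl hk a' z' aa'|i].
    exact: hk (agree_le kl aa').
  exact: (proj2 (hh i)) az.
exists m => a' z' aa' a'z'; apply: hn (hf _ _ a'z').
by apply: hN => i; exact: hm aa' a'z'.
Qed.

Lemma limit_QCB0_P : QCB0_P limit_space.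
Proof. exact: QCB0_P_naming limit_T0 limit_naming limit_projective. Qed.

End limits.

Lemma QCB0_P_data (X : topologicalType) : QCB0_P X ->
  kolmogorov_space X /\ exists rho,
    [/\ @admissible_naming X rho, naming rho & projective (EQn rho)].
Proof.
move=> /QCB0_PP[qX [rho ar pr]]; split; first by case: qX.
by exists rho; split=> //; exact: admissible_qcb0_naming.
Qed.

Lemma QCB0_P_finite_limits : inherits_finite_limits QCB0_P.
Proof.
move=> J F hF.
have h i := QCB0_P_data (hF i).
pose rho i := projT1 (cid (proj2 (h i))).
have rhoP i : [/\ admissible_naming (@rho i), naming (@rho i) &
    projective (EQn (@rho i))] by rewrite /rho; case: cid.
exists (limit_space rho).
  by apply: limit_QCB0_P => i; [case: (h i)|case: (rhoP i)..].
by exists (@limit_proj _ _ rho); apply: limit_spaceP => i; [case: (h i)|case: (rhoP i)..].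
Qed.

(** * Finite colimits *)

Lemma cons_tail (n : nat) (p : baire) : p 0 = n -> consB n (tailB p) = p.
Proof. by move=> <-; apply/funext => -[]. Qed.

Lemma agree_cons n m p q : agree n p q -> agree n (consB m p) (consB m q).
Proof. by move=> h [|i] ni //=; apply: h; exact: ltnW. Qed.

Lemma agree_tail n p q : agree n.+1 p q -> agree n (tailB p) (tailB q).
Proof. by move=> h i ni; exact: h. Qed.

Lemma projective_head (i : nat) : projective [set p : baire | p 0 = i].
Proof.
apply: projective_open; rewrite openE => p pi; apply/nbhs_baireP.
by exists 1 => q pq /=; rewrite -(pq 0).
Qed.

Section colimits.
Variables (J : fincat) (F : diagram J) (rho : forall i, baire -> F i -> Prop).
Hypotheses (T0F : forall i, kolmogorov_space (F i))
  (nam : forall i, naming (@rho i))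
  (pE : forall i, projective (EQn (@rho i))).

(* Codes of open subsets of the coproduct of the F i that are saturated for the
   relation generated by the maps of the diagram. *)
Definition colimit_code : set baire :=
  [set p | forall (i j : J) (u : fhom i j) a b x, rho a x -> rho b (dmap u x) ->
     Ob p (consB (pickle i) a) <-> Ob p (consB (pickle j) b)].

(** A point of the colimit is the set of saturated codes whose open set contains it. Points that no
    saturated open set separates thus become equal, which is the T0-quotient. *)
Definition colimit_class (i : J) (x : F i) : set baire :=
  [set p | colimit_code p /\ exists2 a, rho a x & Ob p (consB (pickle i) a)].

Lemma colimit_classE p i (x : F i) a : colimit_code p -> rho a x ->
  colimit_class x p <-> Ob p (consB (pickle i) a).
Proof.
move=> cp ax; split=> [[_ [b bx]]|]; last by split=> //; exists a.
(* The identity arrow makes saturation include independence of the chosen name of x. *)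
by rewrite (cp _ _ (fid i) b a x) ?dmap1.
Qed.

Definition colimit_points : Type :=
  {A : set baire | exists i (x : F i), A = colimit_class x}.

(** The first entry of a name selects the summand, the tail names a point in it. *)
Definition colimit_names (p : baire) (A : colimit_points) : Prop :=
  exists i (x : F i),
    [/\ p 0 = pickle i, rho (tailB p) x & sval A = colimit_class x].

Definition colimit_space : topologicalType := final colimit_names.

Definition colimit_point i (x : F i) : colimit_points :=
  exist _ (colimit_class x) (ex_intro _ i (ex_intro _ x erefl)).

Definition colimit_inj i (x : F i) : colimit_space := colimit_point x.

Lemma colimit_points_eq (A B : colimit_points) : sval A = sval B -> A = B.
Proof. by case: A B => [A hA] [B hB] /= h; apply: eq_exist. Qed.

Lemma colimit_injP (A : colimit_space) : exists i (x : F i), A = colimit_inj x.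
Proof.
case: (A : colimit_points) => B [i [x e]].
by exists i, x; exact: colimit_points_eq.
Qed.

Lemma colimit_names_inj p i (x : F i) : p 0 = pickle i -> rho (tailB p) x ->
  colimit_names p (colimit_point x).
Proof. by move=> pi px; exists i, x. Qed.

Lemma colimit_names_functional : functional colimit_names.
Proof.
move=> p A B [i [x [pi px eA]]] [j [y [pj py eB]]]; apply: colimit_points_eq.
have ij : i = j by apply: (pcan_inj pickleK); rewrite -pi -pj.
move: y py eB; rewrite -ij => y py ->; rewrite eA.
by have [fr _ _] := nam i; rewrite (fr _ _ _ px py).
Qed.

Lemma colimit_names_onto : onto colimit_names.
Proof.
move=> A; have [i [x ->]] := colimit_injP A.
have [_ orr _] := nam i; have [a ax] := orr x.
by exists (consB (pickle i) a); apply: colimit_names_inj.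
Qed.

Lemma colimit_naming : @naming colimit_space colimit_names.
Proof. exact: final_naming colimit_names_functional colimit_names_onto. Qed.

Lemma colimit_T0 : kolmogorov_space colimit_space.
Proof.
apply/T0P => A B h; apply: colimit_points_eq.
have cls (C : colimit_space) p : sval (C : colimit_points) p -> colimit_code p.
  by have [i [x ->]] := colimit_injP C; case.
have oU p : colimit_code p ->
    open [set C : colimit_space | sval (C : colimit_points) p].
  have [_ _ cO] := colimit_naming.
  move=> cp; apply/cO => q C [i [x [qi qx eC]]].
  rewrite /= eC => /(colimit_classE cp qx).
  rewrite cons_tail // => /Ob_agree[n hn]; exists n => q' C' qq'.
  move=> [j [y [q'j q'y ->]]]; apply/(colimit_classE cp q'y).
  by rewrite cons_tail //; exact: hn.
apply/seteqP; split=> p Cp.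
  exact: (proj1 (h _ (oU p (cls A p Cp)))).
exact: (proj2 (h _ (oU p (cls B p Cp)))).
Qed.

Lemma colimit_inj_continuous i : continuous (@colimit_inj i).
Proof.
apply: (continuous_naming (nam i)) => U oU a x ax Ux.
have [n hn] := oU _ _ (@colimit_names_inj (consB (pickle i) a) i x erefl ax) Ux.
exists n => b y ab by_; apply: (hn (consB (pickle i) b)); first exact: agree_cons.
exact: colimit_names_inj.
Qed.

Lemma colimit_cocone : cocone colimit_inj.
Proof.
split; first exact: colimit_inj_continuous.
move=> i j u x; apply: colimit_points_eq => /=; apply/seteqP.
have [_ oi _] := nam i; have [_ oj _] := nam j.
have [a ax] := oi x; have [b bx] := oj (dmap u x).
split=> p pc; have [cp _] := pc; move: pc.
  by move=> /(colimit_classE cp bx) pb; apply/(colimit_classE cp ax)/(cp _ _ u a b x).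
by move=> /(colimit_classE cp ax) pa; apply/(colimit_classE cp bx)/(cp _ _ u a b x).
Qed.

(** The pullback of an open set of [Z] along the cocone is a saturated open subset of the coproduct,
    so it has a code, and equal classes contain the same codes. Hence the two images lie in the same
    open sets of the T0 space [Z]. *)
Lemma colimit_class_cocone (Z : topologicalType) (tau : forall i, F i -> Z) i j
    (x : F i) (y : F j) :
  kolmogorov_space Z -> cocone tau -> colimit_class x = colimit_class y ->
  tau i x = tau j y.
Proof.
move=> T0Z [ctau tauM].
have key i' j' (x' : F i') (y' : F j') U : colimit_class x' = colimit_class y' ->
    open U -> U (tau i' x') -> U (tau j' y').
  move=> exy oU Ux.
  pose A (a : baire) := exists k (z : F k),
    [/\ a 0 = pickle k, rho (tailB a) z & U (tau k z)].
  have oA : open_on (fun p : baire => p)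
      [set a | exists k (z : F k), a 0 = pickle k /\ rho (tailB a) z] (fun _ => A).
    move=> z0 a _ [k [z [ak az Uz]]].
    have [_ _ rO] := nam k; move/continuousP: (ctau k) => /(_ _ oU)/rO oUk.
    have [n hn] := oUk _ _ az Uz.
    exists n.+1 => _ b _ ab [l [w [bl bw]]].
    have kl : k = l by apply: (pcan_inj pickleK); rewrite -ak -bl (ab 0).
    move: w bw; rewrite -kl in bl *; move=> w bw; exists k, w; split=> //.
    exact: hn (agree_tail ab) bw.
  have [g _ hg] := open_on_code embedded_id oA.
  have H k (z : F k) a : rho a z ->
      Ob (g (fun=> 0)) (consB (pickle k) a) <-> U (tau k z).
    move=> az; rewrite hg; last by exists k, z.
    split=> [[l [w [kl aw]]]|Uz]; last by exists k, z.
    have {}kl : k = l by apply: (pcan_inj pickleK).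
    move: w aw; rewrite -kl => w aw.
    by have [fr _ _] := nam k; rewrite (fr _ _ _ az aw).
  have cg : colimit_code (g (fun=> 0)).
    by move=> k l u a b z az bz; rewrite (H _ _ _ az) (H _ _ _ bz) tauM.
  have [_ oi _] := nam i'; have [_ oj _] := nam j'.
  have [a ax] := oi x'; have [b bx] := oj y'.
  apply/(H _ _ _ bx)/(colimit_classE cg bx); rewrite -exy.
  by apply/(colimit_classE cg ax)/(H _ _ _ ax).
move=> exy; apply: ((T0P _).1 T0Z) => U oU.
by split; exact: key.
Qed.

Lemma colimit_spaceP : is_colimit colimit_inj.
Proof.
split; [exact: naming_qcb0 colimit_T0 colimit_naming|exact: colimit_cocone|].
move=> Z tau [T0Z _] ctau.
have /choice[f hf] : forall A : colimit_space, exists z, forall i (x : F i),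
    A = colimit_inj x -> z = tau i x.
  move=> A; have [i [x ->]] := colimit_injP A; exists (tau i x) => j y e.
  apply: colimit_class_cocone => //.
  exact: (congr1 (fun B : colimit_points => sval B) e).
have fE i (x : F i) : f (colimit_inj x) = tau i x by exact: hf.
exists f; split; last first.
  move=> g [_ hg]; apply/funext => A; have [i [x ->]] := colimit_injP A.
  by rewrite fE hg.
split=> //; apply: (continuous_naming colimit_naming) => U oU p A.
move=> [i [x [pi px eA]]].
have -> : A = colimit_inj x by exact: colimit_points_eq.
rewrite /preimage /= fE => Ux.
have [_ _ rO] := nam i.
have /rO oUi : open (tau i @^-1` U) by move/continuousP: (proj1 ctau i); exact.
have [n hn] := oUi _ _ px Ux.
exists n.+1 => q B pq [j [y [qj qy eB]]].
have ij : i = j by apply: (pcan_inj pickleK); rewrite -pi -qj (pq 0).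
move: y qy eB; rewrite -ij => y qy eB.
have -> : B = colimit_inj y by exact: colimit_points_eq.
by rewrite fE; exact: hn (agree_tail pq) qy.
Qed.

Lemma projective_colimit_code : projective colimit_code.
Proof.
apply: (projective_ext (B := fun c : baire => forall i j : J, forall u : fhom i j,
  forall a b : baire, graph_names (@rho i) (@rho j) (dmap u) (a, b) ->
    Ob c (consB (pickle i) a) <-> Ob c (consB (pickle j) b))).
  move=> c; split=> [h i j u a b [x ax bx]|h i j u a b x ax bx].
    exact: (h i j u a b x ax bx).
  by apply: (h i j u a b); exists x.
apply: projective_finite_forall => i; apply: projective_finite_forall => j.
apply: projective_finite_forall => u.
have pG : projective (graph_names (@rho i) (@rho j) (dmap u)).
  by apply: projective_graph => //; exact: dmap_continuous.
solve_projective.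
Qed.

Lemma colimit_projective : projective (EQn colimit_names).
Proof.
pose dom (p : baire) := exists i : J, p 0 = pickle i /\
  EQn (@rho i) (tailB p, tailB p).
apply: (projective_ext (B := fun pq : baire * baire => dom pq.1 /\ dom pq.2 /\
  forall c : baire, colimit_code c -> Ob c pq.1 <-> Ob c pq.2)).
  move=> [p q] /=; split.
    move=> [A [i [x [/= pi px eA]]] [j [y [/= qj qy eA']]]].
    split; first by exists i; split=> //; exists x.
    split; first by exists j; split=> //; exists y.
    move=> c cc; rewrite -(cons_tail pi) -(cons_tail qj).
    by rewrite -(colimit_classE cc px) -(colimit_classE cc qy) -eA -eA'.
  move=> [[i [pi [x px _]]] [[j [qj [y qy _]]] h]].
  exists (colimit_point x); first exact: colimit_names_inj.
  exists j, y; split=> //=; apply/seteqP; split=> c cc; have [hc _] := cc; move: cc.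
    move=> /(colimit_classE hc px); rewrite cons_tail // => /(h _ hc).
    by move=> qc; apply/(colimit_classE hc qy); rewrite cons_tail.
  move=> /(colimit_classE hc qy); rewrite cons_tail // => /(h _ hc).
  by move=> pc; apply/(colimit_classE hc px); rewrite cons_tail.
have pC := projective_colimit_code.
have pD : projective (dom : set baire).
  apply: projective_finite_exists => i; apply: projectiveI; first exact: projective_head.
  apply: (projective_preimage (f := fun u => (tailB u, tailB u))) (pE i).
  solve_continuous.
solve_projective.
Qed.

Lemma colimit_QCB0_P : QCB0_P colimit_space.
Proof. exact: QCB0_P_naming colimit_T0 colimit_naming colimit_projective. Qed.

End colimits.

Lemma QCB0_P_finite_colimits : inherits_finite_colimits QCB0_P.
Proof.
move=> J F hF.
have h i := QCB0_P_data (hF i).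
pose rho i := projT1 (cid (proj2 (h i))).
have rhoP i : [/\ admissible_naming (@rho i), naming (@rho i) &
    projective (EQn (@rho i))] by rewrite /rho; case: cid.
exists (colimit_space rho).
  by apply: colimit_QCB0_P => i; [case: (h i)|case: (rhoP i)..].
exists (@colimit_inj _ _ rho); apply: colimit_spaceP => i; case: (rhoP i) => //.
Qed.

(** * Exponentials *)

Section arrows.
Variable T : finType.

(** [false] is the source and [true] the target of the arrows indexed by [T]. *)
Definition arrows_hom (i j : bool) : finType :=
  if i then (if j then unit : finType else void : finType)
  else (if j then T else unit : finType).

Definition arrows_id (i : bool) : arrows_hom i i :=
  if i return arrows_hom i i then tt else tt.

Definition arrows_comp (i j k : bool) :
    arrows_hom i j -> arrows_hom j k -> arrows_hom i k :=
  match i, j, k with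
  | false, false, false => fun _ _ => tt
  | false, false, true => fun _ u => u
  | false, true, true => fun u _ => u
  | true, true, true => fun _ _ => tt
  | true, false, _ => fun v _ => match v with end
  | _, true, false => fun _ v => match v with end
  end.

Lemma arrows_compA i j k l (u : arrows_hom i j) (v : arrows_hom j k)
    (w : arrows_hom k l) :
  arrows_comp u (arrows_comp v w) = arrows_comp (arrows_comp u v) w.
Proof. by case: i j k l u v w => [] [] [] [] //= []. Qed.

Lemma arrows_comp1m i j (u : arrows_hom i j) : arrows_comp (arrows_id i) u = u.
Proof. by case: i j u => [] [] //= []. Qed.

Lemma arrows_compm1 i j (u : arrows_hom i j) : arrows_comp u (arrows_id j) = u.
Proof. by case: i j u => [] [] //= []. Qed.

(* Two objects and a family of parallel arrows between them: no arrow for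
   products, two arrows for equalizers and coequalizers. *)
Definition arrows : fincat := Fincat arrows_compA arrows_comp1m arrows_compm1.

Variables (X Y : topologicalType) (f : T -> X -> Y).
Hypothesis cf : forall t, continuous (f t).

Definition arrows_ob (i : bool) : topologicalType := if i then Y else X.

Definition arrows_map (i j : bool) :
    arrows_hom i j -> arrows_ob i -> arrows_ob j :=
  match i, j with
  | false, false => fun _ x => x
  | false, true => f
  | true, true => fun _ x => x
  | true, false => fun v => match v with end
  end.

Lemma arrows_map_continuous i j (u : arrows_hom i j) : continuous (arrows_map u).
Proof. by case: i j u => [] [] //= u; exact: continuous_ident. Qed.

Lemma arrows_map1 i x : arrows_map (arrows_id i) x = x.
Proof. by case: i x. Qed.

Lemma arrows_mapM i j k (u : arrows_hom i j) (v : arrows_hom j k) x :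
  arrows_map (arrows_comp u v) x = arrows_map v (arrows_map u x).
Proof. by case: i j k u v x => [] [] [] //= []. Qed.

Definition arrows_diagram : diagram arrows :=
  @Diagram arrows arrows_ob arrows_map arrows_map_continuous arrows_map1 arrows_mapM.

End arrows.

Definition no_arrow (X Y : Type) (v : void) : X -> Y := match v with end.

Lemma no_arrow_continuous (X Y : topologicalType) v : continuous (@no_arrow X Y v).
Proof. by case: v. Qed.

Definition pair_diagram (X Y : topologicalType) : diagram (arrows void) :=
  arrows_diagram (@no_arrow_continuous X Y).

Definition both (A : bool -> Type) (x : A false) (y : A true) (b : bool) : A b :=
  if b return A b then y else x.

Lemma limit_product (X Y P : topologicalType)
    (pi : forall i : arrows void, P -> pair_diagram X Y i) :
  is_limit pi -> @is_product X Y P (pi false) (pi true).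
Proof.
move=> [qP [cpi _] univ]; split=> //; [exact: (cpi false)|exact: (cpi true)|].
move=> Z f g qZ cf cg.
pose tau := @both (fun b => Z -> arrows_ob X Y b) f g.
have ctau : @cone _ (pair_diagram X Y) Z tau.
  by split=> [[]|[] [] [] x].
have [h [[ch hh] uh]] := univ Z tau qZ ctau.
exists h; split; first by split=> // z; [exact: (hh false)|exact: (hh true)].
by move=> k [ck k1 k2]; apply: uh; split=> // -[].
Qed.

Lemma sub_baire_T0 (D : set baire) : kolmogorov_space (D : topologicalType).
Proof.
apply/T0P => x y h; apply: set_val_inj; apply/funext => i; apply/esym.
have o : open [set d : D | set_val d i = set_val x i].
  rewrite openE => d di; apply/embedded_val; exists i.+1 => d' dd' /=.
  by rewrite -(dd' i).
by apply/(h _ o).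
Qed.

Lemma sub_baire_qcb0 (D : set baire) : qcb0 (D : topologicalType).
Proof.
apply: second_countable_qcb0; [exact: sub_baire_T0|exact: second_countable_sub].
Qed.

Lemma nat_qcb0 : qcb0 nat.
Proof. by have [? []] := QCB0_P_nat. Qed.

Section products.
Variables (X Y P : topologicalType) (p1 : P -> X) (p2 : P -> Y).
Hypothesis prodP : is_product p1 p2.

Lemma product_map (Z : topologicalType) (f : Z -> X) (g : Z -> Y) :
  qcb0 Z -> continuous f -> continuous g -> exists h : Z -> P,
    [/\ continuous h, forall z, p1 (h z) = f z & forall z, p2 (h z) = g z].
Proof.
have [_ _ _ univ] := prodP; move=> qZ cf cg.
by have [h [hh _]] := univ Z f g qZ cf cg; exists h.
Qed.

(** Points are viewed as constant maps out of the nonempty qcb0-space [nat], to which the uniqueness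
    clause applies. *)
Lemma product_eq w w' : p1 w = p1 w' -> p2 w = p2 w' -> w = w'.
Proof.
have [_ c1 c2 univ] := prodP; move=> e1 e2.
have [h [_ uh]] := univ nat (fun=> p1 w) (fun=> p2 w) nat_qcb0
  (@continuous_const _ _ _) (@continuous_const _ _ _).
have hw : h = fun=> w by apply: uh; split=> //; exact: continuous_const.
have hw' : h = fun=> w' by apply: uh; split=> //; exact: continuous_const.
by rewrite hw in hw'; have := congr1 (fun k : nat -> P => k 0) hw'.
Qed.

Lemma product_pair x y : exists w, p1 w = x /\ p2 w = y.
Proof.
have [h [_ h1 h2]] := product_map nat_qcb0 (@continuous_const nat _ x)
  (@continuous_const nat _ y).
by exists (h 0).
Qed.

End products.

Lemma QCB0_P_product (X Y : topologicalType) : QCB0_P X -> QCB0_P Y ->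
  exists2 P, QCB0_P P & exists (p1 : P -> X) (p2 : P -> Y), is_product p1 p2.
Proof.
move=> hX hY; have [|P hP [pi piP]] := QCB0_P_finite_limits (F := pair_diagram X Y).
  by case.
by exists P => //; exists (pi false), (pi true); exact: limit_product.
Qed.

(** * The function space, named by codes of maps *)

Section exponentials.
Variables (X Y : topologicalType) (rhoX : baire -> X -> Prop)
  (rhoY : baire -> Y -> Prop).
Hypotheses (T0X : kolmogorov_space X) (T0Y : kolmogorov_space Y)
  (aX : admissible_naming rhoX) (nX : naming rhoX) (nY : naming rhoY)
  (pX : projective (EQn rhoX)) (pY : projective (EQn rhoY)).

Definition exp_points : Type := {f : X -> Y | continuous f}.

Definition exp_tests : set baire :=
  [set k | (exists x, rhoX (part1 k) x) /\ saturated_code rhoY (part2 k)].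

Definition exp_passes (f : exp_points) : set baire :=
  [set k | exists2 x, rhoX (part1 k) x & coded_open rhoY (sval f x) (part2 k)].

Definition exp_names : baire -> exp_points -> Prop :=
  code_naming exp_tests exp_passes.

Definition exp_space : topologicalType := final exp_names.

Lemma exp_points_eq (f g : exp_points) : (forall x, sval f x = sval g x) -> f = g.
Proof. by case: f g => [f cf] [g cg] /= h; apply: eq_exist; exact/funext. Qed.

Lemma exp_passesE f k x : rhoX (part1 k) x ->
  exp_passes f k <-> coded_open rhoY (sval f x) (part2 k).
Proof.
have [fX _ _] := nX; move=> kx; split=> [[y ky]|]; last by exists x.
by rewrite (fX _ _ _ kx ky).
Qed.

Lemma exp_passes_inj f g :
  (forall k, exp_tests k -> exp_passes f k <-> exp_passes g k) -> f = g.
Proof.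
move=> h; apply: exp_points_eq => x; apply: (coded_open_inj nY T0Y) => p Pp.
have [_ oX _] := nX; have [a ax] := oX x.
have kx : rhoX (part1 (pair2 a p)) x by rewrite part1_pair.
have := h (pair2 a p); rewrite !(exp_passesE _ kx) part2_pair; apply.
by split; [exists x|rewrite part2_pair].
Qed.

Lemma exp_names_functional : functional exp_names.
Proof.
move=> e f g ef eg; apply: exp_passes_inj => k Kk.
exact: (iff_trans (iff_sym (ef k Kk)) (eg k Kk)).
Qed.

Lemma exp_names_onto : onto exp_names.
Proof.
move=> f; have [c hc] := code_map nX nY (proj2_sig f).
exists c => k [[x kx] Pk]; rewrite (exp_passesE _ kx); exact: hc.
Qed.

Lemma exp_naming : @naming exp_space exp_names.
Proof. exact: final_naming exp_names_functional exp_names_onto. Qed.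

Lemma exp_admissible : @admissible_naming exp_space exp_names.
Proof.
apply: (admissible_code_naming exp_naming); [|exact: exp_passes_inj|].
  move=> e f k ef Kk /(ef _ Kk) /Ob_agree[n hn]; exists n => e' f' k' ee' e'f' kk' Kk'.
  by apply/(e'f' _ Kk'); exact: hn.
by move=> U; have [_ _ eO] := exp_naming; move/eO.
Qed.

Lemma exp_T0 : kolmogorov_space exp_space.
Proof.
apply/T0P => f g h; apply: exp_passes_inj => k Kk.
apply: (h [set f' : exp_space | exp_passes f' k]).
have [_ _ eO] := exp_naming; apply/eO => e f' ef' /(ef' _ Kk) /Ob_agree[n hn].
by exists n => e' f'' ee' e'f''; apply/(e'f'' _ Kk); exact: hn.
Qed.

Lemma projective_exp_tests : projective exp_tests.
Proof.
apply: (projective_ext (B := fun k : baire =>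
  EQn rhoX (part1 k, part1 k) /\ saturated_code rhoY (part2 k))).
  by move=> k; rewrite EQn_named.
have pS := projective_saturated pY.
solve_projective.
Qed.

(** Points and maps are eliminated: at each name a, the tests passed by [e] must be the codes around
    some point of [Y], and they must depend only on the point that a names. Continuity of the
    resulting map is automatic, since a passed test is witnessed by finitely many values of a. *)
Lemma exp_named e : (exists f, exp_names e f) <->
  (forall a : baire, EQn rhoX (a, a) -> exists b : baire, EQn rhoY (b, b) /\
     forall p : baire, saturated_code rhoY p -> Ob e (pair2 a p) <-> Ob p b) /\
  forall k : baire, exp_tests k -> forall a : baire, EQn rhoX (part1 k, a) ->
    Ob e k <-> Ob e (pair2 a (part2 k)).
Proof.
have Kpair a x p : rhoX a x -> saturated_code rhoY p -> exp_tests (pair2 a p).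
  by move=> ax Pp; split; [exists x; rewrite part1_pair|rewrite part2_pair].
split=> [[f ef]|[h1 h2]].
  have H a x p : rhoX a x -> saturated_code rhoY p ->
      Ob e (pair2 a p) <-> coded_open rhoY (sval f x) p.
    move=> ax Pp; rewrite (ef _ (Kpair _ _ _ ax Pp)) (exp_passesE _ (x := x)).
      by rewrite part2_pair.
    by rewrite part1_pair.
  split=> [a [x ax _]|k Kk a [x kx ax]].
    have [_ oY _] := nY; have [b bfx] := oY (sval f x).
    exists b; split=> [|p Pp]; first by exists (sval f x).
    by rewrite (H _ _ _ ax Pp); exact: coded_openE.
  have [_ Pk] := Kk.
  by rewrite (H _ _ _ ax Pk) (ef _ Kk); exact: exp_passesE.
have [_ oX XO] := nX.
have /choice[f hf] : forall x, exists y, forall a, rhoX a x ->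
    forall p, saturated_code rhoY p -> Ob e (pair2 a p) <-> coded_open rhoY y p.
  move=> x; have [a0 a0x] := oX x.
  have [b [[y by_ _] hb]] := h1 a0 (ex_intro2 _ _ x a0x a0x).
  exists y => a ax p Pp.
  have := h2 _ (Kpair _ _ _ a0x Pp) a; rewrite part1_pair part2_pair => <-.
    by rewrite hb // (coded_openE Pp by_).
  by exists x.
have cf : continuous f.
  apply: (continuous_naming nX) => U /(open_coded nY)[p Pp pU] a x ax.
  rewrite /preimage /= -pU => /(hf _ _ ax _ Pp)/Ob_agree[n hn].
  have cp : continuous (fun a : baire => pair2 a p) by solve_continuous.
  have [m hm] := continuous_agree a n cp.
  exists m => a' x' aa' a'x'; apply/pU/(hf _ _ a'x' _ Pp).
  by apply: hn => //; exact: hm.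
exists (exist _ f cf) => k Kk; have [[x kx] Pk] := Kk.
(* [k] is not assumed to be literally [pair2 (part1 k) (part2 k)]; the second condition, used with
   the same name, bridges the two. *)
rewrite (exp_passesE _ kx) (h2 _ Kk (part1 k)); last by exists x.
exact: hf.
Qed.

Lemma exp_projective : projective (EQn exp_names).
Proof.
pose dom (e : baire) :=
  (forall a : baire, EQn rhoX (a, a) -> exists b : baire, EQn rhoY (b, b) /\
     forall p : baire, saturated_code rhoY p -> Ob e (pair2 a p) <-> Ob p b) /\
  forall k : baire, exp_tests k -> forall a : baire, EQn rhoX (part1 k, a) ->
    Ob e k <-> Ob e (pair2 a (part2 k)).
apply: (projective_ext (B := fun ee : baire * baire => dom ee.1 /\
  forall k : baire, exp_tests k -> Ob ee.1 k <-> Ob ee.2 k)).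
  move=> [e e'] /=; split=> [[f ef e'f]|[/exp_named[f ef] h]].
    split=> [|k Kk]; first by apply/exp_named; exists f.
    exact: (iff_trans (ef k Kk) (iff_sym (e'f k Kk))).
  exists f => // k Kk /=; exact: (iff_trans (iff_sym (h k Kk)) (ef k Kk)).
have pS := projective_saturated pY.
have pK := projective_exp_tests.
have pD : projective (dom : set baire) by rewrite /dom; solve_projective.
solve_projective.
Qed.

Lemma exp_QCB0_P : QCB0_P exp_space.
Proof. exact: QCB0_P_naming exp_T0 exp_naming exp_projective. Qed.

Variables (P : topologicalType) (p1 : P -> exp_space) (p2 : P -> X).
Hypothesis prodP : is_product p1 p2.

Definition exp_ev (w : P) : Y := sval (p1 w : exp_points) (p2 w).

(** Realizers of both projections turn a name of w into a name of the map and a name of its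
    argument; the value lies in the open set of q exactly when the first passes the test made of the
    second and q. *)
Lemma exp_ev_continuous : continuous exp_ev.
Proof.
have [qP c1 c2 _] := prodP; have [rhoP nP] := qcb0_naming qP.
have [h1 [h1N h1c]] := admissible_realizer nP exp_admissible c1.
have [h2 [h2N h2c]] := admissible_realizer nP aX c2.
apply: (continuous_naming nP) => U /(open_coded nY)[q Pq qU] c w cw.
have key c' w' : rhoP c' w' -> Ob (h1 c') (pair2 (h2 c') q) <-> U (exp_ev w').
  move=> c'w'; have x' : rhoX (part1 (pair2 (h2 c') q)) (p2 w').
    by rewrite part1_pair; exact: h2N.
  rewrite (h1N _ _ c'w'); last by split; [exists (p2 w')|rewrite part2_pair].
  by rewrite (exp_passesE _ x') part2_pair.
move=> /(key _ _ cw)/Ob_agree[n hn].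
have cp : continuous (fun a : baire => pair2 a q) by solve_continuous.
have [m hm] := continuous_agree (h2 c) n cp.
have [n1 hn1] := h1c _ _ n cw; have [n2 hn2] := h2c _ _ m cw.
exists (maxn n1 n2) => c' w' cc' c'w'; apply/(key _ _ c'w'); apply: hn.
  exact: hn1 (agree_maxl cc') c'w'.
by apply: hm; exact: hn2 (agree_maxr cc') c'w'.
Qed.

(** Along names of pairs (z, x) the map [f] is continuous, so [open_on_lift] makes the tests passed
    by g z open jointly in a name of z and the test. Coding this relation sends names of z
    continuously to names of g z. *)
Lemma exp_transpose (Z Q : topologicalType) (q1 : Q -> Z) (q2 : Q -> X)
    (f : Q -> Y) (g : Z -> exp_space) : qcb0 Z -> is_product q1 q2 ->
  continuous f -> (forall w, sval (g (q1 w) : exp_points) (q2 w) = f w) ->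
  continuous g.
Proof.
move=> qZ prodQ cf fg; have [rhoZ nZ] := qcb0_naming qZ.
have [fZ oZ ZO] := nZ; have [fX oX XO] := nX.
pose names (k : baire) (zx : Z * X) := rhoZ (part1 k) zx.1 /\ rhoX (part2 k) zx.2.
have fn : functional names.
  by move=> k [z x] [z' x'] [/= kz kx] [/= kz' kx']; rewrite (fZ _ _ _ kz kz') (fX _ _ _ kx kx').
have on : onto names.
  move=> [z x]; have [a az] := oZ z; have [b bx] := oX x.
  by exists (pair2 a b); split; rewrite /= ?part1_pair ?part2_pair.
have [D [delta hd]] := naming_representation fn on.
have dN d : names (set_val d) (delta d) by apply/hd; exists d.
have cz : continuous (fun d => (delta d).1).
  apply/continuousP => U /ZO oU; rewrite openE => d Ud; apply/embedded_val.
  have [n hn] := oU _ _ (proj1 (dN d)) Ud.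
  have [m hm] := continuous_agree (set_val d) n continuous_part1.
  by exists m => d' /hm dd'; exact: hn dd' (proj1 (dN d')).
have cx : continuous (fun d => (delta d).2).
  apply/continuousP => U /XO oU; rewrite openE => d Ud; apply/embedded_val.
  have [n hn] := oU _ _ (proj2 (dN d)) Ud.
  have [m hm] := continuous_agree (set_val d) n continuous_part2.
  by exists m => d' /hm dd'; exact: hn dd' (proj2 (dN d')).
(* The topology of [Q] is known only through its universal property; the qcb0-space [D] of names of
   pairs provides a continuous map into it. *)
have [t [ct t1 t2]] := product_map prodQ (sub_baire_qcb0 D) cz cx.
have H := open_on_lift nY (coded_open_on (rho := rhoY)) (@embedded_val D)
  (continuous_compose ct cf).
pose DZ : set baire := [set a | exists z, rhoZ a z].
have /choice[zeta hzeta] : forall a : DZ, exists z, rhoZ (set_val a) z.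
  by move=> a; exact: (set_valP a).
have oA : open_on (@set_val baire DZ) exp_tests (fun a => exp_passes (g (zeta a))).
  move=> a k [_ Pk] [x kx fx].
  have /hd[d dk dzx] : names (pair2 (set_val a) (part1 k)) (zeta a, x).
    by split; rewrite /= ?part1_pair ?part2_pair.
  have ftd : f (t d) = sval (g (zeta a) : exp_points) x.
    by rewrite -fg t1 t2 dzx.
  have Ad : coded_open rhoY (f (t d)) (part2 k) by rewrite ftd.
  have [n hn] := H _ _ Pk Ad.
  have cp : continuous (fun u : baire * baire => pair2 u.1 (part1 u.2)).
    by solve_continuous.
  have : nbhs (set_val a, k) [set u : baire * baire |
      agree n (pair2 (set_val a) (part1 k)) (pair2 u.1 (part1 u.2))].
    by apply: (cp (set_val a, k)); exact: nbhs_agree.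
  case=> -[B C] /= [/nbhs_baireP[m1 hm1] /nbhs_baireP[m2 hm2]] BC.
  have [m3 hm3] := continuous_agree k n continuous_part2.
  exists (maxn m1 (maxn m2 m3)) => a' k' aa' kk' [[x' x'k'] Pk'].
  exists x' => //.
  have /hd[d' d'k' d'zx] : names (pair2 (set_val a') (part1 k')) (zeta a', x').
    by split; rewrite /= ?part1_pair ?part2_pair.
  have -> : sval (g (zeta a') : exp_points) x' = f (t d').
    by rewrite -fg t1 t2 d'zx.
  apply: hn Pk'; last exact: hm3 (agree_maxr (agree_maxr kk')).
  rewrite dk d'k'; apply: (BC (set_val a', k')); split => /=.
    exact: hm1 (agree_maxl aa').
  exact: hm2 (agree_maxl (agree_maxr kk')).
have [G cG hG] := open_on_code (@embedded_val DZ) oA.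
apply: (continuous_naming nZ) => U; have [_ _ eO] := exp_naming.
move=> /eO oU b z bz Uz.
have mk b' z' : rhoZ b' z' -> exists2 a : DZ, set_val a = b' & zeta a = z'.
  move=> bz'; have Db : b' \in DZ by apply/mem_set; exists z'.
  by exists (exist _ b' Db) => //; exact: fZ (hzeta (exist _ b' Db)) bz'.
have [a ab az] := mk _ _ bz.
have Ga a' : exp_names (G a') (g (zeta a')) by move=> k Kk; exact: hG.
have Ua : U (g (zeta a)) by rewrite az.
have [n hn] := oU _ _ (Ga a) Ua.
have /embedded_val[m hm] := cG a _ (nbhs_agree (G a) n).
exists m => b' z' bb' b'z'; have [a' ab' <-] := mk _ _ b'z'.
by apply: hn (Ga a'); apply: hm; rewrite ab ab'.
Qed.

Lemma exp_spaceP : is_exponential p1 p2 exp_ev.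
Proof.
split=> //; first exact: naming_qcb0 exp_T0 exp_naming.
  exact: exp_ev_continuous.
move=> Z Q q1 q2 f qZ prodQ cf.
have qX : qcb0 X := naming_qcb0 T0X nX.
(* The section x |-> (z, x) of the product; [f] restricted along it is the map g z. *)
have slc z : exists h : X -> Q,
    [/\ continuous h, forall x, q1 (h x) = z & forall x, q2 (h x) = x].
  exact: (product_map prodQ qX (@continuous_const X Z z) (@continuous_ident X)).
have /choice[g hg] : forall z, exists g : exp_points,
    forall w, q1 w = z -> sval g (q2 w) = f w.
  move=> z; have [h [ch h1 h2]] := slc z.
  exists (exist _ _ (continuous_compose ch cf)) => w wz /=; congr f.
  by apply: (product_eq prodQ); rewrite ?h1 ?h2.
have fg w : sval (g (q1 w) : exp_points) (q2 w) = f w by exact: hg.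
have cg : continuous (g : Z -> exp_space) := exp_transpose qZ prodQ cf fg.
have [_ cq1 cq2 _] := prodQ; have [qQ _ _ _] := prodQ.
exists g; split.
  split=> //.
  have [h [ch h1 h2]] := product_map prodP qQ (continuous_compose cq1 cg) cq2.
  by exists h; split=> // w; rewrite /exp_ev h1 h2.
move=> g' [_ [h [_ h1 h2 h3]]]; apply/funext => z.
apply: exp_points_eq => x; have [w [<- <-]] := product_pair prodQ z x.
by rewrite fg -h3 /exp_ev h1 h2.
Qed.

End exponentials.

Lemma QCB0_P_exponentials : inherits_exponentials QCB0_P.
Proof.
move=> X Y hX hY.
have [T0X [rX [aX nX pX]]] := QCB0_P_data hX.
have [T0Y [rY [aY nY pY]]] := QCB0_P_data hY.
have hE : QCB0_P (exp_space rX rY) by exact: exp_QCB0_P.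
exists (exp_space rX rY) => //.
have [P _ [p1 [p2 prodP]]] := QCB0_P_product hE hX.
by exists P, p1, p2, (exp_ev p1 p2); exact: exp_spaceP.
Qed.

Lemma QCB0_P_closed : closed_subcategory QCB0_P.
Proof.
split; [by move=> X [n []]|exact: QCB0_P_exponentials|exact: QCB0_P_finite_limits|
  exact: QCB0_P_finite_colimits|].
by split; [exact: QCB0_P_sierpinski|exact: QCB0_P_nat].
Qed.

(** * Minimality *)

(** Up to homeomorphism, the subspaces of the Baire space. They are stable under subspaces and
    binary products, and their Tychonoff products are products of qcb0-spaces. *)
Definition embeddable (Z : topologicalType) : Prop :=
  exists2 e : Z -> baire, embedded e & injective e.

Lemma embeddable_T0 (Z : topologicalType) : embeddable Z -> kolmogorov_space Z.
Proof.
move=> [e emb einj]; apply/T0P => x y h; apply: einj; apply/funext => i; apply/esym.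
have o : open [set z : Z | e z i = e x i].
  by rewrite openE => z zi; apply/emb; exists i.+1 => z' zz' /=; rewrite -(zz' i).
by apply/(h _ o).
Qed.

Lemma embeddable_qcb0 (Z : topologicalType) : embeddable Z -> qcb0 Z.
Proof.
move=> embZ; have T0 := embeddable_T0 embZ; have [e emb einj] := embZ.
apply: (@naming_qcb0 _ (fun p z => e z = p)) => //; split=> [p x y <- /einj //|x|U].
  by exists (e x).
split=> [oU p x <- Ux|h].
  have /emb[n hn] : nbhs x U by apply: open_nbhs_nbhs.
  by exists n => q y xy qy; apply: hn; rewrite qy.
rewrite openE => x Ux; apply/emb; have [n hn] := h _ _ erefl Ux.
by exists n => y xy; apply: hn xy _.
Qed.

Lemma embeddable_sub (Z : topologicalType) (D : set Z) :
  embeddable Z -> embeddable (D : topologicalType).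
Proof.
move=> [e emb einj]; exists (fun d => e (set_val d)); last first.
  by move=> [x Dx] [y Dy] /einj /= xy; apply: eq_exist.
move=> d A; split=> [/nbhs_sub[B /emb[n Bn] BA]|[n An]].
  by exists n => d' dd'; apply: BA; exact: Bn.
apply/nbhs_sub; exists [set z | agree n (e (set_val d)) (e z)].
  by apply/emb; exists n.
by move=> d'; exact: An.
Qed.

Lemma embeddable_baire : embeddable baire.
Proof. by exists (fun p => p); [exact: embedded_id|move=> ? ?]. Qed.

Lemma embeddable_nat : embeddable nat.
Proof.
exists (fun n => fun=> n) => [n A|n m /(congr1 (fun p => p 0)) //].
rewrite nbhs_nat; split=> [An|[k h]]; last exact: h.
by exists 1 => m /(_ 0 isT) <-.
Qed.

Lemma embeddable_prod (Z W : topologicalType) :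
  embeddable Z -> embeddable W -> embeddable (Z * W)%type.
Proof.
move=> [e emb einj] [e' emb' einj']; exists (fun zw => pair2 (e zw.1) (e' zw.2)).
  move=> [z w] A; split.
    move=> [[B B'] /= [/emb[n hn] /emb'[n' hn']] BA].
    have [m hm] := continuous_agree (pair2 (e z) (e' w)) n continuous_part1.
    have [m' hm'] := continuous_agree (pair2 (e z) (e' w)) n' continuous_part2.
    exists (maxn m m') => -[z1 w1] /= h; apply: BA; split=> /=.
      by apply: hn; have := hm _ (agree_maxl h); rewrite !part1_pair.
    by apply: hn'; have := hm' _ (agree_maxr h); rewrite !part2_pair.
  move=> [n hn].
  have c : continuous (fun u : baire * baire => pair2 u.1 u.2) by solve_continuous.
  have : nbhs (e z, e' w) [set u : baire * baire |
      agree n (pair2 (e z) (e' w)) (pair2 u.1 u.2)].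
    by apply: (c (e z, e' w)); exact: nbhs_agree.
  case=> -[B B'] /= [/nbhs_baireP[m hm] /nbhs_baireP[m' hm']] BB.
  exists ([set z1 | agree m (e z) (e z1)], [set w1 | agree m' (e' w) (e' w1)]).
    by split; [apply/emb; exists m|apply/emb'; exists m'].
  move=> [z1 w1] [/= zz1 ww1]; apply: hn; apply: (BB (e z1, e' w1)).
  by split; [exact: hm|exact: hm'].
move=> [z w] [z1 w1] /= h; congr pair.
  by apply: einj; have := congr1 part1 h; rewrite !part1_pair.
by apply: einj'; have := congr1 part2 h; rewrite !part2_pair.
Qed.

Lemma embeddable_homeomorphic (Z W : topologicalType) :
  homeomorphic W Z -> embeddable Z -> embeddable W.
Proof.
move=> [f [g [cf cg fg gf]]] [e emb einj]; exists (fun w => e (f w)); last first.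
  by move=> x y /einj /(can_inj fg).
move=> w A; split=> [Aw|[n hn]].
  have /emb[n hn] : nbhs (f w) (g @^-1` A) by apply: cg; rewrite fg.
  by exists n => w' /hn /=; rewrite fg.
have : nbhs w (f @^-1` [set z | agree n (e (f w)) (e z)]).
  by apply: cf; apply/emb; exists n.
by apply: filterS => w'; exact: hn.
Qed.

Lemma embeddable_neq (Z : topologicalType) :
  embeddable Z -> open [set z : Z * Z | z.1 <> z.2].
Proof.
move=> [e emb einj]; rewrite openE => -[x y] /= xy.
have [i xyi] : exists i, e x i <> e y i.
  by apply: contrapT => /forallNP h; apply: xy; apply: einj; apply/funext => i;
    apply: contrapT.
rewrite /interior; exists ([set z | agree i.+1 (e x) (e z)],
    [set z | agree i.+1 (e y) (e z)]).
  by split; apply/emb; exists i.+1.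
move=> [x' y'] [/= xx' yy'] e'; apply: xyi.
by rewrite (xx' i) // (yy' i) // e'.
Qed.

Lemma embeddable_is_product (X Y : topologicalType) :
  embeddable X -> embeddable Y -> is_product (@fst X Y) (@snd X Y).
Proof.
move=> eX eY; split; [exact/embeddable_qcb0/embeddable_prod|exact: continuous_fst|
  exact: continuous_snd|].
move=> Z f g _ cf cg; exists (fun z => (f z, g z)); split.
  by split=> //; exact: continuous_pair.
by move=> h [_ h1 h2]; apply/funext => z; rewrite -h1 -h2; case: (h z).
Qed.

Lemma homeomorphic_refl (X : topologicalType) : homeomorphic X X.
Proof. by exists id, id; split=> //; exact: continuous_ident. Qed.

Definition truth (X : Type) (U : set X) (x : X) : sierpinski := `[< U x >].

Lemma truth_continuous (X : topologicalType) (U : set X) :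
  open U -> continuous (truth U).
Proof.
move=> oU; apply/continuousP => V /sierpinski_openE hV.
have [Vf|nVf] := pselect (V false).
  have -> : truth U @^-1` V = setT.
    by apply/seteqP; split=> // x _; rewrite /preimage /= /truth; case: asbool => //; exact: hV.
  exact: openT.
have [Vt|nVt] := pselect (V true).
  have -> : truth U @^-1` V = U => //.
  by apply/seteqP; split=> x; rewrite /preimage /= /truth; case: asboolP.
have -> : truth U @^-1` V = set0.
  by apply/seteqP; split=> // x; rewrite /preimage /= /truth; case: asbool.
exact: open0.
Qed.

(** * Copies of spaces in a subcategory with the closure properties *)

Section minimality.
Variable C : topologicalType -> Prop.
Hypothesis closedC : closed_subcategory C.

Definition copy_in (X : topologicalType) : Prop :=
  exists2 Y, C Y & homeomorphic X Y.

Lemma copy_in_self X : C X -> copy_in X.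
Proof. by exists X => //; exact: homeomorphic_refl. Qed.

(** The maps are transported to objects of [C], where they have an equalizer. The comparison maps
    with [X] are mutually inverse by injectivity of [e] on one side and by uniqueness of mediating
    maps on the other. *)
Lemma copy_in_equalizer (A B X : topologicalType) (f g : A -> B) (e : X -> A) :
  copy_in A -> copy_in B -> continuous f -> continuous g -> continuous e ->
  qcb0 X -> injective e -> (forall x, f (e x) = g (e x)) ->
  (forall (Z : topologicalType) (h : Z -> A), continuous h ->
     (forall z, f (h z) = g (h z)) ->
     exists2 k : Z -> X, continuous k & forall z, e (k z) = h z) ->
  copy_in X.
Proof.
move=> [A0 CA [a [a' [ca ca' aa' a'a]]]] [B0 CB [b [b' [cb cb' bb' b'b]]]].
move=> cf cg ce qX einj fge univX.
pose F t x := b ((if t : bool then f else g) (a' x)).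
have cF t : continuous (F t).
  apply: (continuous_compose _ cb); apply: (continuous_compose ca').
  by case: t.
have [_ _ lim _ _] := closedC.
have [|L CL [pi [qL [cpi piM] univL]]] := lim _ (arrows_diagram cF).
  by case.
have fgL l : f (a' (pi false l)) = g (a' (pi false l)).
  apply: (can_inj bb').
  exact: (etrans (piM false true true l) (esym (piM false true false l))).
have [k2 ck2 ek2] := univX L (fun l => a' (pi false l))
  (continuous_compose (cpi false) ca') fgL.
pose tau := @both (fun i => X -> arrows_ob A0 B0 i) (fun x => a (e x))
  (fun x => b (f (e x))).
have [|k1 [[ck1 pk1] _]] := univL X tau qX.
  split=> [[]|[] [] //= t x].
  - exact: (continuous_compose (continuous_compose ce cf) cb).
  - exact: (continuous_compose ce ca).
  - by rewrite /F aa'; case: t; rewrite ?fge.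
exists L => //; exists k1, k2; split=> // [x|l].
  by apply: einj; rewrite ek2 (pk1 false) /= aa'.
have [m [_ um]] := univL L pi qL (conj cpi piM).
have m1 : m = fun l => l by apply: um; split=> //; exact: continuous_ident.
suff m2 : m = fun l => k1 (k2 l) by rewrite m1 in m2; exact: esym (congr1 (@^~ l) m2).
apply: um; split; first exact: continuous_compose ck2 ck1.
case=> l'; last by rewrite (pk1 false) /= ek2 a'a.
rewrite (pk1 true) /= ek2; exact: (piM false true true l').
Qed.

Lemma copy_in_sub (A B : topologicalType) (f g : A -> B) (D : set A) :
  embeddable A -> copy_in A -> copy_in B -> continuous f -> continuous g ->
  (forall x, D x <-> f x = g x) -> copy_in (D : topologicalType).
Proof.
move=> eA hA hB cf cg hD.
apply: (copy_in_equalizer (e := @set_val A D) hA hB cf cg).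
- exact: continuous_val.
- exact/embeddable_qcb0/embeddable_sub.
- by move=> [x Dx] [y Dy] /= xy; apply: eq_exist.
- by move=> x; apply/hD; exact: (set_valP x).
move=> Z h ch fgh.
have Dh z : h z \in D by apply/mem_set/hD.
exists (fun z => exist _ (h z) (Dh z) : D) => //.
exact: continuous_to_sub.
Qed.

Lemma copy_in_prod (A B : topologicalType) : embeddable A -> embeddable B ->
  copy_in A -> copy_in B -> copy_in (A * B)%type.
Proof.
move=> eA eB [A0 CA [a [a' [ca ca' aa' a'a]]]] [B0 CB [b [b' [cb cb' bb' b'b]]]].
have [_ _ lim _ _] := closedC.
have [|L CL [pi piL]] := lim _ (pair_diagram A0 B0); first by case.
have prodL := limit_product piL; have [_ c1 c2 _] := prodL.
have [k1 [ck1 k11 k12]] := product_map prodL (embeddable_qcb0 (embeddable_prod eA eB))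
    (continuous_compose (@continuous_fst A B) ca) (continuous_compose (@continuous_snd A B) cb).
exists L => //; exists k1, (fun l => (a' (pi false l), b' (pi true l))).
split=> //.
- apply: continuous_pair; first exact: continuous_compose c1 ca'.
  exact: continuous_compose c2 cb'.
- by move=> [x y]; rewrite k11 k12 aa' bb'.
- by move=> l; apply: (product_eq prodL); rewrite ?k11 ?k12 /= ?a'a ?b'b.
Qed.

(** Since [f] and [g] together enumerate the kernel of [q], the colimit injection from [B] is
    constant on the fibres of [q]; it descends to [X], continuously because [q] is a quotient
    map. *)
Lemma copy_in_coequalizer (A B X : topologicalType) (f g : A -> B) (q : B -> X) :
  copy_in A -> copy_in B -> continuous f -> continuous g -> quotient_map q ->
  qcb0 X -> (forall x, q (f x) = q (g x)) ->
  (forall y y', q y = q y' -> exists2 x, f x = y & g x = y') -> copy_in X.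
Proof.
move=> [A0 CA [a [a' [ca ca' aa' a'a]]]] [B0 CB [b [b' [cb cb' bb' b'b]]]].
move=> cf cg [qs qo] qX qfg ker.
pose F t x := b ((if t : bool then f else g) (a' x)).
have cF t : continuous (F t).
  apply: (continuous_compose _ cb); apply: (continuous_compose ca').
  by case: t.
have [_ _ _ colim _] := closedC.
have [|L CL [io [qL [cio ioM] univL]]] := colim _ (arrows_diagram cF); first by case.
have cq : continuous q by apply/continuousP => U /qo.
pose tau := @both (fun i => arrows_ob A0 B0 i -> X) (fun x => q (f (a' x)))
  (fun y => q (b' y)).
have [|k1 [[ck1 k1i] _]] := univL X tau qX.
  split=> [[]|[] [] //= t x].
  - exact: continuous_compose cb' cq.
  - exact: (continuous_compose (continuous_compose ca' cf) cq).
  - by rewrite /F bb'; case: t; rewrite ?qfg.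
have iofg y y' : q y = q y' -> io true (b y) = io true (b y').
  move=> /ker[x <- <-]; have e1 := ioM false true true (a x).
  have e2 := ioM false true false (a x); rewrite /= /F aa' in e1 e2.
  exact: etrans e1 (esym e2).
have /choice[k2 hk2] : forall x, exists l, forall y, q y = x -> l = io true (b y).
  by move=> x; have [y <-] := qs x; exists (io true (b y)) => y' /iofg.
have k2q y : k2 (q y) = io true (b y) by exact: hk2.
have ck2 : continuous k2.
  apply/continuousP => U oU; apply/qo.
  have -> : q @^-1` (k2 @^-1` U) = (fun y => io true (b y)) @^-1` U.
    by apply/seteqP; split=> y; rewrite /preimage /= k2q.
  by have := continuous_compose cb (cio true); move/continuousP; exact.
exists L => //; exists k2, k1; split=> // [x|l].
  by have [y <-] := qs x; rewrite k2q (k1i true) /= bb'.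
have [m [_ um]] := univL L io qL (conj cio ioM).
have m1 : m = fun l => l by apply: um; split=> //; exact: continuous_ident.
suff m2 : m = fun l => k2 (k1 l) by rewrite m1 in m2; exact: esym (congr1 (@^~ l) m2).
apply: um; split; first exact: continuous_compose ck1 ck2.
have ht y : k2 (k1 (io true y)) = io true y by rewrite (k1i true) /= k2q b'b.
case=> // x; have <- := ioM false true true x; exact: ht.
Qed.

(** The exponential E of [nat] by itself is compared with the Baire space: g transposes application,
    k evaluates a point of E at every n. That g after k is the identity follows from uniqueness of
    the transpose of [ev]. *)
Lemma copy_in_baire : copy_in baire.
Proof.
have [_ exp _ _ [_ Cn]] := closedC.
have [E CE [P [p1 [p2 [ev [qE prodP cev univ]]]]]] := exp _ _ Cn Cn.
have prodQ := embeddable_is_product embeddable_baire embeddable_nat.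
have [qP cp1 cp2 _] := prodP.
have capp : continuous (fun w : baire * nat => w.1 w.2).
  apply: continuous_to_nat => -[p n].
  exists (agree n.+1 p, [set n]); first by split; [exact: nbhs_agree|exact/nbhs_nat].
  by move=> [p' n'] /= [pp' ->]; rewrite -(pp' n).
have [g [[cg [h [ch h1 h2 h3]]] _]] :=
  univ _ _ _ _ _ (embeddable_qcb0 embeddable_baire) prodQ capp.
(* The section e |-> (e, n) of the product, along which [ev] is evaluation at n. *)
have /choice[s hs] : forall n : nat, exists s : E -> P,
    [/\ continuous s, forall e, p1 (s e) = e & forall e, p2 (s e) = n].
  move=> n; exact: (product_map prodP qE (@continuous_ident E) (@continuous_const E nat n)).
pose k (e : E) : baire := fun n => ev (s n e).
have kE w : k (p1 w) (p2 w) = ev w.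
  rewrite /k; congr ev; have [_ s1 s2] := hs (p2 w).
  by apply: (product_eq prodP); rewrite ?s1 ?s2.
have ck : continuous k.
  apply: continuous_to_baire => n; have [cs _ _] := hs n.
  exact: continuous_compose cs cev.
exists E => //; exists g, k; split=> // [p|e].
  by apply/funext => n; have := kE (h (p, n)); rewrite h1 h2 h3.
have [m [_ um]] := univ _ _ _ _ _ qE prodP cev.
have m1 : m = fun e => e.
  apply: um; split; first exact: continuous_ident.
  by exists (fun w => w); split=> //; exact: continuous_ident.
suff m2 : m = fun e => g (k e) by rewrite m1 in m2; exact: esym (congr1 (@^~ e) m2).
apply: um; split; first exact: continuous_compose ck cg.
exists (fun w => h (k (p1 w), p2 w)); split=> [|w|w|w].
- apply: (continuous_compose _ ch); apply: continuous_pair => //.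
  exact: continuous_compose cp1 ck.
- by rewrite h1.
- by rewrite h2.
- by rewrite h3 /= kE.
Qed.

(* Inequality in Z is open, so (x, b) |-> (pi b <> x) is a map into the
   Sierpinski space; the set below is the equalizer of its transpose with the
   constantly true map. *)
Lemma copy_in_avoided (Z B : topologicalType) (pi : B -> Z) :
  embeddable Z -> embeddable B -> copy_in Z -> copy_in B -> continuous pi ->
  copy_in ([set x | forall b, pi b <> x] : set Z).
Proof.
move=> eZ eB hZ [B1 CB hB] cpi.
have [u [v [cu cv uv vu]]] := hB.
have eB1 : embeddable B1 by apply: embeddable_homeomorphic eB; exists v, u.
have [_ exp _ _ [CS _]] := closedC.
have [E CE [P [p1 [p2 [ev [qE prodP cev univ]]]]]] := exp _ _ CB CS.
have prodQ := embeddable_is_product eZ eB1.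
pose phi : Z * B1 -> sierpinski := truth [set w | pi (v w.2) <> w.1].
have cphi : continuous phi.
  apply: truth_continuous.
  have c : continuous (fun w : Z * B1 => (pi (v w.2), w.1)).
    apply: continuous_pair; last exact: continuous_fst.
    exact: (continuous_compose (continuous_compose (@continuous_snd _ _) cv) cpi).
  by move/continuousP: c => /(_ _ (embeddable_neq eZ)).
have [f [[cf [hf [chf hf1 hf2 hf3]]] _]] :=
  univ _ _ _ _ _ (embeddable_qcb0 eZ) prodQ cphi.
have [g [[cg [hg [chg hg1 hg2 hg3]]] _]] :=
  univ _ _ _ _ _ (embeddable_qcb0 eZ) prodQ (@continuous_const _ sierpinski true).
apply: (copy_in_sub eZ hZ (copy_in_self CE) cf cg) => x; split=> [h|fgx b e].
  (* The points f x and g x of E are compared as constant maps from [nat]: when every [pi b] avoids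
     x, both transpose the constantly true map. *)
  have prodN := embeddable_is_product embeddable_nat eB1.
  have [m [_ um]] := univ _ _ _ _ _ nat_qcb0 prodN (@continuous_const _ sierpinski true).
  have cx : continuous (fun w : nat * B1 => (x, w.2)).
    by apply: continuous_pair; [exact: continuous_const|exact: continuous_snd].
  have mf : m = fun=> f x.
    apply: um; split; first exact: continuous_const.
    exists (fun w => hf (x, w.2)); split=> [|w|w|w].
    - exact: continuous_compose cx chf.
    - by rewrite hf1.
    - by rewrite hf2.
    - by rewrite hf3 /phi /truth; case: asboolP => // -[]; exact: h.
  have mg : m = fun=> g x.
    apply: um; split; first exact: continuous_const.
    exists (fun w => hg (x, w.2)); split=> [|w|w|w].
    - exact: continuous_compose cx chg.
    - by rewrite hg1.
    - by rewrite hg2.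
    - by rewrite hg3.
  by rewrite mf in mg; exact: (congr1 (@^~ 0) mg).
(* Equal points of E evaluate equally at [u b], so the truth value of pi b <> x is top, against the
   assumed equality. *)
have hfg : hf (x, u b) = hg (x, u b).
  by apply: (product_eq prodP); rewrite ?hf1 ?hg1 ?hf2 ?hg2.
have := hf3 (x, u b); rewrite hfg hg3 /phi /truth; case: asboolP => //.
by rewrite /= uv => -[].
Qed.

Lemma copy_in_complement (Z : topologicalType) (A : set Z) :
  embeddable Z -> copy_in Z -> copy_in (A : topologicalType) ->
  copy_in (~` A : set Z).
Proof.
move=> eZ hZ hA.
have := copy_in_avoided eZ (@embeddable_sub Z A eZ) hZ hA (@continuous_val Z A).
suff -> : [set x | forall b : A, set_val b <> x] = ~` A by [].
apply/seteqP; split=> [x h Ax|x nAx b bx].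
  have Am : x \in A by exact: mem_set.
  exact: (h (exist _ x Am)).
by apply: nAx; rewrite -bx; exact: (set_valP b).
Qed.

(** The complement of the projection consists of the points avoided by the second coordinate on [B];
    a further complement gives the projection itself. *)
Lemma copy_in_projection (Z : topologicalType) (B : set (baire * Z)) :
  embeddable Z -> copy_in Z -> copy_in (B : topologicalType) ->
  let A := [set x | exists p : baire, B (p, x)] in
  copy_in (A : topologicalType) /\ copy_in (~` A : set Z).
Proof.
move=> eZ hZ hB A.
suff h : copy_in (~` A : set Z).
  by split=> //; rewrite -[A]setCK; exact: copy_in_complement.
have eB := @embeddable_sub _ B (embeddable_prod embeddable_baire eZ).
have := copy_in_avoided eZ eB hZ hB
  (continuous_compose (@continuous_val _ B) (@continuous_snd baire Z)).
suff -> : [set x | forall b : B, (set_val b).2 <> x] = ~` A by [].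
apply/seteqP; split=> [x h [p Bx]|x nAx b bx].
  have Bm : (p, x) \in B by exact: mem_set.
  exact: (h (exist _ (p, x) Bm)).
apply: nAx; exists (set_val b).1; rewrite -bx -surjective_pairing.
exact: (set_valP b).
Qed.

(** The difference equalizes two maps into the square of the Sierpinski space: the pair of
    characteristic maps of [U] and [V], and the constant (true, false). *)
Lemma copy_in_open_difference (Z : topologicalType) (U V : set Z) :
  embeddable Z -> copy_in Z -> open U -> open V -> copy_in (U `\` V : set Z).
Proof.
move=> eZ hZ oU oV; have [_ _ lim _ [CS _]] := closedC.
have [|L CL [pi piL]] := lim _ (pair_diagram sierpinski sierpinski); first by case.
have prodL := limit_product piL.
have qZ := embeddable_qcb0 eZ.
have [f [cf f1 f2]] := product_map prodL qZ (truth_continuous oU) (truth_continuous oV).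
have [g [cg g1 g2]] := product_map prodL qZ (@continuous_const Z sierpinski true)
  (@continuous_const Z sierpinski false).
apply: (copy_in_sub eZ hZ (copy_in_self CL) cf cg) => x; split=> [[Ux nVx]|fg].
  by apply: (product_eq prodL); rewrite ?f1 ?f2 ?g1 ?g2 /truth; case: asboolP.
have := f1 x; rewrite fg g1 /truth; case: asboolP => // Ux _.
by have := f2 x; rewrite fg g2 /truth; case: asboolP.
Qed.

(** The set and its complement are treated together, because the next level projects a set whose
    complement is given. Level zero is a projection of one difference of open sets. *)
Lemma copy_in_Sigma1 n (Z : topologicalType) (A : set Z) :
  embeddable Z -> copy_in Z -> Sigma1 n A ->
  copy_in (A : topologicalType) /\ copy_in (~` A : set Z).
Proof.
elim: n Z A => [|n IH] Z A eZ hZ;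
  have eBZ := embeddable_prod embeddable_baire eZ;
  have hBZ := copy_in_prod embeddable_baire eZ copy_in_baire hZ.
  case=> U [V [oU oV eA]].
  have [U' [V' [oU' oV' h]]] := Sigma1_0_projection oU oV.
  rewrite (h _ eA); apply: copy_in_projection => //.
  exact: copy_in_open_difference.
case=> B /(IH _ _ eBZ hBZ)[_ hB] ->; apply: copy_in_projection => //.
by rewrite -[B]setCK.
Qed.

Lemma copy_in_QCB0_P (X : topologicalType) : QCB0_P X -> copy_in X.
Proof.
move=> hX; have [qX _] := (QCB0_PP X).1 hX.
have [_ [rho [_ nr pr]]] := QCB0_P_data hX; have [fr orr rO] := nr.
have [D [delta hd]] := naming_representation fr orr.
have eD : rho = names_of delta.
  by apply/funext => p; apply/funext => x; apply/propext; rewrite hd.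
have [n Sn] := pr.
have e2 := embeddable_prod embeddable_baire embeddable_baire.
have h2 := copy_in_prod embeddable_baire embeddable_baire copy_in_baire copy_in_baire.
have [hE _] := copy_in_Sigma1 e2 h2 Sn.
(* The domain is the diagonal section of the kernel and is therefore projective as well. *)
have DE p : D p <-> EQn rho (p, p).
  split=> [Dp|[x /= /hd[d <- _] _]]; last exact: (set_valP d).
  have Dm : p \in D by exact: mem_set.
  by exists (delta (exist _ p Dm)); apply/hd; exists (exist _ p Dm).
have [m Sm] : projective D.
  apply: (projective_ext (B := fun p : baire => EQn rho (p, p))); first exact: DE.
  solve_projective.
have [hD _] := copy_in_Sigma1 embeddable_baire copy_in_baire Sm.
pose R : set (baire * baire) := EQn rho.
have R1 (r : R) : (set_val r).1 \in D.
  have [x /hd[d <- _] _] : EQn rho (set_val r) by exact: (set_valP r).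
  by apply/mem_set; exact: (set_valP d).
have R2 (r : R) : (set_val r).2 \in D.
  have [x _ /hd[d <- _]] : EQn rho (set_val r) by exact: (set_valP r).
  by apply/mem_set; exact: (set_valP d).
pose f (r : R) : D := exist _ (set_val r).1 (R1 r).
pose g (r : R) : D := exist _ (set_val r).2 (R2 r).
(* [X] is the coequalizer of the two projections from the kernel to the domain. *)
apply: (copy_in_coequalizer (f := f) (g := g) (q := delta) hE hD) => //.
- apply: continuous_to_sub.
  exact: continuous_compose (@continuous_val _ R) (@continuous_fst _ _).
- apply: continuous_to_sub.
  exact: continuous_compose (@continuous_val _ R) (@continuous_snd _ _).
- split=> [x|U]; first by have [p /hd[d _ dx]] := orr x; exists d.
  by rewrite rO eD; exact: final_open_names_of.
- move=> r; have [x r1 r2] : EQn rho (set_val r) by exact: (set_valP r).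
  have H (d : D) : rho (set_val d) x -> delta d = x.
    by move=> /hd[d' /set_val_inj <- <-].
  by rewrite (H (f r)) // (H (g r)).
- move=> d d' dd'.
  have Rm : (set_val d, set_val d') \in R.
    by apply/mem_set; exists (delta d); apply/hd; [exists d|exists d'].
  by exists (exist _ (set_val d, set_val d') Rm); apply: set_val_inj.
Qed.

End minimality.

Theorem theorem7p5 :
  closed_subcategory QCB0_P /\
  forall C : topologicalType -> Prop, closed_subcategory C ->
  forall X : topologicalType, QCB0_P X ->
  exists2 Y : topologicalType, C Y & homeomorphic X Y.
Proof.
split; first exact: QCB0_P_closed.
by move=> C closedC X; exact: copy_in_QCB0_P.
Qed.
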